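(* Let $G=(V,E)$ be a DAG with integer netflow vector $\alpha$, and let $(\hat G,\hat\alpha,\hat{\mathcal F})$ be a framed augmentation of $(G,\alpha)$. Then \[ \mathcal T(\hat G,\hat\alpha,\hat{\mathcal F}):=\{\check\Delta_1(\mathcal L)\ :\ \mathcal L \text{ is a layering-simplex of }(\hat G,\hat\alpha,\hat{\mathcal F})\} \] is a unimodular lattice triangulation of the flow polytope $\mathcal F_G(\alpha)$.
   Context: All graphs are finite. A DAG is a directed graph without oriented cycles; an edge $e$ has tail $t(e)$ and head $h(e)$; $\mathrm{in}(v)$, $\mathrm{out}(v)$ are the incoming/outgoing edges of $v$. A source has no incoming edges, a sink no outgoing edges. A netflow vector is $\alpha\in\mathbb Z^V$; an $\alpha$-flow is $F:E\to\mathbb R_{\ge 0}$ with $\sum_{e\in \mathrm{out}(i)}F(e)-\sum_{e\in\mathrm{in}(i)}F(e)=\alpha_i$ for all $i$; $\mathcal F_G(\alpha)\subseteq\mathbb R^E$ is the polytope of $\alpha$-flows. The strength is $S_\alpha=\sum_{\alpha_i>0}\alpha_i$. Augmentation: $(\hat G,\hat\alpha)$ with $\hat G=(\hat V,\hat E)$, $\hat V=V\sqcup V_X\sqcup V_Y$, $\hat E=E\sqcup E_X\sqcup E_Y$, where $E_X$ is a set of $S_\alpha$ inflow edges from $V_X$ to $\{i\in V:\alpha_i>0\}$ with exactly $\alpha_i$ of them having head $i$ for each $i$ with $\alpha_i>0$; $E_Y$ is a set of outflow edges with tails in $\{i\in V:\alpha_i<0\}$ and heads in $V_Y$, with between $1$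 and $|\alpha_i|$ of them having tail $i$ for each $i$ with $\alpha_i<0$; each vertex of $V_X$ (resp. $V_Y$) is incident to exactly one edge, which lies in $E_X$ (resp. $E_Y$); and $\hat\alpha$ is $0$ on $V$, $1$ on $V_X$, negative on $V_Y$, with $\alpha_i=\sum_{y\in E_Y,\,t(y)=i}\hat\alpha_{h(y)}$ whenever $\alpha_i<0$. A framing $\hat{\mathcal F}$ of $(\hat G,\hat\alpha)$ consists of a total order on the outgoing edges of $\hat G$ at each $i\in V$, a total order on the incoming edges of $\hat G$ at each $i\in V$, and a total order $s_1<\dots<s_{S_\alpha}$ on $V_X$. A route is a directed path in $\hat G$ from a source to a sink. For a vertex $i$ and distinct paths $p,q$ from $i$ to a sink, let $\sigma$ be their maximal common initial subpath (starting at $i$), ending at $v$; if $p$ continues with edge $f$ and $q$ with $g$ where $f<g$ in the order on outgoing edges at $v$, write $p<_i^+q$. Dually, for distinct paths $p,q$ from a source to $i$, let $\sigma$ be their maximal common final subpath (ending at $i$), starting at $v$; if $p$ contains $f\sigma$ and $q$ contains $g\sigma$ with $f<g$ in the order on incoming edges at $v$, write $p<_i^-q$. For routes $p,q$ through $i$ compare their subpaths after (resp. before) $i$, writing $=_i^{\pm}$ when these subpaths agree. Routes $p,q$ are incompatible at a shared vertex $i$ if (up to swapping) $p<_i^-q$ and $q<_i^+p$; they are compatible if incompatible at no shared vertex. A route-clique is a set of pairwise compatible routes. A layering is a set $L$ of routes such that for each source $i$ of $\hat G$ exactly $\hat\alpha_i$ routes of $L$ begin at $i$ (so exactly one at each vertex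 of $V_X$), and for each sink $j$ exactly $|\hat\alpha_j|$ routes end at $j$. Write $L=\{L_1,\dots,L_{S_\alpha}\}$ with $L_i$ starting at $s_i$. For distinct layerings $L,M$, take the maximal $i$ with $L_i\ne M_i$; then $L<_{\mathrm{src}}^+M$ if $L_i<_{s_i}^+M_i$ (a total order). For a set $\mathcal L$ of layerings, $\mathrm{routes}(\mathcal L)$ is the union of its layerings. A set $\mathcal L=\{L^1<_{\mathrm{src}}^+\dots<_{\mathrm{src}}^+L^m\}$ of layerings is a layering-simplex if (1) $\mathrm{routes}(\mathcal L)$ is a route-clique; (2) for each $i\in[m]$, $L^i$ is the $<_{\mathrm{src}}^+$-minimum among all layerings $L$ with $L\subseteq\mathrm{routes}(\{L^i,\dots,L^m\})$; (3) for each $i\in[m]$ some route of $L^i$ is not in $\mathrm{routes}(\{L^{i+1},\dots,L^m\})$. For a route $p$, $\check I(p)\in\mathbb R^E$ is the indicator vector of the edges of $E$ used by $p$; $\check J(L)=\sum_{p\in L}\check I(p)$; $\check\Delta_1(\mathcal L)=\mathrm{conv}\{\check J(L):L\in\mathcal L\}$. A lattice triangulation of an integer polytope $P$ is a finite set $\mathcal T$ of integer simplices with union $P$, closed under taking faces, and such that any two intersect in a (possibly empty) common face; it is unimodular if each simplex has normalized volume $1$ in its affine span (with respect to the lattice of integer points).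
   Formalization: The formal theorem assumes α ≠ 0: for α = 0 the flow polytope is {0}, but the only layering is the empty one, which violates condition (3) of a layering-simplex, so the union of the cells is empty and the claim fails. *)

(* Defs.v *)
From mathcomp Require Import all_boot all_order all_algebra.
From mathcomp Require Import finmap.
From mathcomp Require Import boolp classical_sets functions cardinality reals.

Set Implicit Arguments.
Unset Strict Implicit.
Unset Printing Implicit Defensive.

Import Order.TTheory GRing.Theory Num.Theory.
Local Open Scope ring_scope.

Record digraph := Digraph {
  vertex : finType;
  arc : finType;
  tail : arc -> vertex;
  head : arc -> vertex }.

Section Digraph.
Variable G : digraph.
Implicit Types (u v : vertex G) (e : arc G).

Definition is_source v := [forall e : arc G, head e != v].
Definition is_sink v := [forall e : arc G, tail e != v].

Fixpoint dipath u (s : seq (arc G)) v : bool :=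
  if s is e :: s' then (tail e == u) && dipath (head e) s' v else u == v.

Definition is_dag := forall v (s : seq (arc G)), s != [::] -> ~~ dipath v s v.

(* A path is its initial vertex together with its sequence of arcs; the
   vertex only matters for paths of length 0. *)
Definition gpath : Type := vertex G * seq (arc G).

Definition path_end (p : gpath) : vertex G := last p.1 [seq head e | e <- p.2].

Definition is_route (p : gpath) : bool :=
  [&& is_source p.1, is_sink (path_end p) & dipath p.1 p.2 (path_end p)].

Definition strength (alpha : vertex G -> int) : int :=
  \sum_(i | 0 < alpha i) alpha i.

End Digraph.

Record augmentation (G : digraph) (alpha : vertex G -> int) := Augmentation {
  VX : finType;
  VY : finType;
  EX : finType;
  EY : finType;
  tailX : EX -> VX;
  headX : EX -> vertex G;
  tailY : EY -> vertex G;
  headY : EY -> VY;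
  netflowY : VY -> int;
  card_EX : #|EX|%:Z = strength alpha;
  headX_gt0 : forall e, 0 < alpha (headX e);
  card_headX : forall i, 0 < alpha i ->
    #|[set e | headX e == i]|%:Z = alpha i;
  tailY_lt0 : forall e, alpha (tailY e) < 0;
  card_tailY : forall i, alpha i < 0 ->
    1 <= #|[set e | tailY e == i]|%:Z <= `|alpha i|;
  card_tailX : forall x, #|[set e | tailX e == x]| = 1%N;
  card_headY : forall y, #|[set e | headY e == y]| = 1%N;
  netflowY_lt0 : forall y, netflowY y < 0;
  netflowY_sum : forall i, alpha i < 0 ->
    alpha i = \sum_(e | tailY e == i) netflowY (headY e) }.

Section Augmented.
Variables (G : digraph) (alpha : vertex G -> int) (A : augmentation alpha).

Definition aug_vertex : finType := (vertex G + VX A + VY A)%type.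
Definition aug_arc : finType := (arc G + EX A + EY A)%type.

Definition inV (v : vertex G) : aug_vertex := inl (inl v).
Definition inX (x : VX A) : aug_vertex := inl (inr x).
Definition inY (y : VY A) : aug_vertex := inr y.
Definition inE (e : arc G) : aug_arc := inl (inl e).

Definition aug_tail (e : aug_arc) : aug_vertex :=
  match e with
  | inl (inl e) => inV (tail e)
  | inl (inr e) => inX (tailX e)
  | inr e => inV (tailY e)
  end.

Definition aug_head (e : aug_arc) : aug_vertex :=
  match e with
  | inl (inl e) => inV (head e)
  | inl (inr e) => inV (headX e)
  | inr e => inY (headY e)
  end.

Definition aug_graph : digraph := Digraph aug_tail aug_head.

Definition aug_netflow (v : vertex aug_graph) : int :=
  match v with
  | inl (inl _) => 0
  | inl (inr _) => 1
  | inr y => netflowY y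
  end.

End Augmented.

Definition strict_total_order_on (T : finType) (D : {pred T}) (lt : rel T) :=
  [/\ {in D, irreflexive lt},
      {in D & &, transitive lt} &
      {in D &, forall x y, x != y -> lt x y || lt y x}].

Record framing (G : digraph) (alpha : vertex G -> int)
    (A : augmentation alpha) := Framing {
  out_lt : vertex G -> rel (arc (aug_graph A));
  in_lt : vertex G -> rel (arc (aug_graph A));
  src_lt : rel (VX A);
  out_ltP : forall i, strict_total_order_on
    [pred e : arc (aug_graph A) | tail e == inV A i] (out_lt i);
  in_ltP : forall i, strict_total_order_on
    [pred e : arc (aug_graph A) | head e == inV A i] (in_lt i);
  src_ltP : strict_total_order_on predT src_lt }.

Section Layerings.
Variables (G : digraph) (alpha : vertex G -> int) (A : augmentation alpha).
Variable F : framing A.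

Local Notation hG := (aug_graph A).
Local Notation harc := (arc hG).
Local Notation route := (gpath hG).
Local Notation layering := {fset route}.

(* [p <_i^+ q] for (the arc sequences of) two paths starting at the same
   vertex; [s] is their maximal common initial subpath. *)
Definition path_out_lt (p q : seq harc) : Prop :=
  exists (v : vertex G) (s p' q' : seq harc) (f g : harc),
    [/\ p = s ++ f :: p', q = s ++ g :: q',
        f != g, tail f = inV A v & out_lt F v f g].

(* [p <_i^- q] for (the arc sequences of) two paths ending at the same
   vertex; [s] is their maximal common final subpath. *)
Definition path_in_lt (p q : seq harc) : Prop :=
  exists (v : vertex G) (s p' q' : seq harc) (f g : harc),
    [/\ p = p' ++ f :: s, q = q' ++ g :: s,
        f != g, head f = inV A v & in_lt F v f g].

Definition crossing_at (i : vertex hG) (p q : route) : Prop :=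
  exists p1 p2 q1 q2 : seq harc,
    [/\ p.2 = p1 ++ p2 /\ path_end (p.1, p1) = i,
        q.2 = q1 ++ q2 /\ path_end (q.1, q1) = i,
        path_in_lt p1 q1 & path_out_lt q2 p2].

Definition incompatible_at (i : vertex hG) (p q : route) : Prop :=
  crossing_at i p q \/ crossing_at i q p.

Definition compatible (p q : route) : Prop :=
  forall i, ~ incompatible_at i p q.

Definition route_clique (K : {fset route}) : Prop :=
  (forall p, p \in K -> is_route p) /\
  (forall p q, p \in K -> q \in K -> compatible p q).

Definition is_layering (L : layering) : Prop :=
  [/\ forall p, p \in L -> is_route p,
      forall i : vertex hG, is_source i ->
        #|` [fset p in L | p.1 == i]%fset |%:Z = aug_netflow i &
      forall j : vertex hG, is_sink j ->
        #|` [fset p in L | path_end p == j]%fset |%:Z = `|aug_netflow j| ].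

(* [x] is the largest element of [V_X] at which the routes of [L] and [M]
   starting there, [p] and [q], differ. *)
Definition layering_lt (L M : layering) : Prop :=
  exists (x : VX A) (p q : route),
    [/\ p \in L /\ p.1 = inX x,
        q \in M /\ q.1 = inX x,
        path_out_lt p.2 q.2 &
        forall (y : VX A) (r : route), src_lt F x y -> r.1 = inX y ->
          (r \in L) = (r \in M)].

Definition routes (Ls : seq layering) : {fset route} :=
  (\bigcup_(L <- Ls) L)%fset.

(* A finite set of layerings is given by its elements
   [L^1 < ... < L^m] listed in increasing order, indexed from 0; hence
   [drop i Ls] lists [L^(i+1), ..., L^m]. *)
Definition layering_simplex (Ls : seq layering) : Prop :=
  [/\ (forall L, L \in Ls -> is_layering L) /\
      (forall i j : nat, (i < j < size Ls)%N ->
         layering_lt (nth fset0 Ls i) (nth fset0 Ls j)),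
      route_clique (routes Ls),
      forall (i : nat) (L : layering), (i < size Ls)%N ->
        is_layering L -> (L `<=` routes (drop i Ls))%fset ->
        L = nth fset0 Ls i \/ layering_lt (nth fset0 Ls i) L &
      forall i : nat, (i < size Ls)%N ->
        exists2 p, p \in nth fset0 Ls i & p \notin routes (drop i.+1 Ls)].

End Layerings.

Section Geometry.
Variables (R : realType) (E : finType).

Local Notation vec := {ffun E -> R^o}.

Definition conv (X : set vec) : set vec :=
  [set x | exists (n : nat) (a : 'I_n -> R) (v : 'I_n -> vec),
    [/\ forall i, 0 <= a i, \sum_i a i = 1, forall i, X (v i) &
        x = \sum_i a i *: v i]]%classic.

Definition integer_point (x : vec) : Prop := forall e, (x e : R) \is a Num.int.

Definition edge_vectors (v0 : vec) (s : seq vec) : seq vec :=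
  [seq v - v0 | v <- s].

Definition affinely_independent (s : seq vec) : bool :=
  if s is v0 :: s' then free (edge_vectors v0 s') else true.

Definition integer_polytope (P : set vec) : Prop :=
  exists s : seq vec,
    (forall v, v \in s -> integer_point v) /\ P = conv [set` s]%classic.

(* The empty set is a simplex, with no vertices. *)
Definition integer_simplex (S : set vec) : Prop :=
  exists s : seq vec,
    [/\ forall v, v \in s -> integer_point v,
        affinely_independent s & S = conv [set` s]%classic].

(* The faces of a simplex are the convex hulls of the subsets, possibly
   empty, of its vertices. *)
Definition face (F S : set vec) : Prop :=
  exists s t : seq vec,
    [/\ affinely_independent s, S = conv [set` s]%classic,
        {subset t <= s} & F = conv [set` t]%classic].

(* [b] is a Z-basis of the lattice of integer points of [W], and also a basis
   of the vector space [W]. *)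
Definition lattice_basis (d : nat) (W : {vspace vec}) (b : d.-tuple vec) :=
  [/\ basis_of W b,
      forall i, integer_point (tnth b i) &
      forall x, x \in W -> integer_point x ->
        exists c : 'I_d -> int, x = \sum_i tnth b i *~ c i].

(* The normalized volume of a d-dimensional simplex with vertices
   [v0, s_1, ..., s_d] is d! times its volume, where volume is scaled so that
   a fundamental parallelepiped of the lattice of integer points parallel to
   its affine span has volume 1.  In coordinates with respect to a basis [b]
   of this lattice it is the absolute value of the determinant of the edge
   vectors [s_i - v0]. *)
Definition has_normalized_volume (S : set vec) (k : R) : Prop :=
  exists (d : nat) (v0 : vec) (s b : d.-tuple vec),
    [/\ affinely_independent (v0 :: s), S = conv [set` v0 :: s]%classic,
        lattice_basis <<edge_vectors v0 s>>%VS b &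
        k = `|\det (\matrix_(i < d, j < d) (coord b j (tnth s i - v0) : R))| ].

Definition lattice_triangulation (P : set vec) (T : set (set vec)) : Prop :=
  [/\ integer_polytope P,
      finite_set T /\ (forall S, T S -> integer_simplex S),
      (\bigcup_(S in T) S)%classic = P,
      forall S F, T S -> face F S -> T F &
      forall S S', T S -> T S' ->
        face (S `&` S')%classic S /\ face (S `&` S')%classic S'].

Definition unimodular (T : set (set vec)) : Prop :=
  forall S, T S -> (S !=set0)%classic -> has_normalized_volume S 1.

End Geometry.

Section FlowPolytope.
Variables (R : realType) (G : digraph) (alpha : vertex G -> int).

Definition flow_polytope : set {ffun arc G -> R^o} :=
  [set x : {ffun arc G -> R^o} | (forall e, 0 <= (x e : R)) /\
    forall i : vertex G,
      \sum_(e | tail e == i) (x e : R) - \sum_(e | head e == i) (x e : R)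
        = (alpha i)%:~R]%classic.

Variables (A : augmentation alpha).

Definition route_indicator (p : gpath (aug_graph A)) : {ffun arc G -> R^o} :=
  [ffun e => (inE A e \in p.2)%:R].

Definition layering_vector (L : {fset gpath (aug_graph A)}) : {ffun arc G -> R^o} :=
  \sum_(p <- L) route_indicator p.

Definition layering_polytope (Ls : seq {fset gpath (aug_graph A)}) :
    set {ffun arc G -> R^o} :=
  conv [set layering_vector L | L in [set` Ls]]%classic.

Definition layering_triangulation (F : framing A) :
    set (set {ffun arc G -> R^o}) :=
  [set layering_polytope Ls | Ls in layering_simplex F]%classic.

End FlowPolytope.

Arguments flow_polytope R {G} alpha.
Arguments layering_triangulation R {G alpha A} F.

(* Main.v *)
(* A flow on the augmented graph is viewed as a fluid of particles: at every vertex the incoming arcs, in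
   framing order, and the outgoing arcs, in framing order, tile the same interval, and a particle keeps its
   position when it crosses the vertex. The amounts of fluid following the various routes decompose the flow
   over a route-clique; the decomposition is unique since at every vertex a clique induces a monotone
   coupling, and it is integral when the flow is. Given such weights on routes, Hall's theorem finds a
   layering in their support; subtracting as much as possible of the minimal one, and repeating, writes the
   flow as a positive combination of the layerings of a layering-simplex, and conditions (2) and (3) force
   every step of this greedy process. Uniqueness of the simplex and of its positive coefficients makes the
   cells a triangulation; integrality of the route weights makes it unimodular. *)

Require Import Defs.
From mathcomp Require Import boolp classical_sets functions cardinality reals.
From mathcomp Require Import all_boot all_order all_algebra finmap.
From mathcomp Require Import lra zify.

Set Implicit Arguments.
Unset Strict Implicit.
Unset Printing Implicit Defensive.

Import Order.TTheory GRing.Theory Num.Theory.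
Local Open Scope ring_scope.

(** * Intervals, monotone couplings and Hall's theorem *)

(** The weight of a route is not a local quantity, but the weight of an initial part of a route is:
    it is shared out among the arcs leaving its end. Existence and uniqueness are therefore proved
    for weights on all paths from a source, by induction on a rank of the last arc that acyclicity
    supplies. The intervals attached to paths come from the flow by sums, differences, maxima and
    minima alone, which is why integral flows give integral weights.

    Uniqueness and integrality are available for nonnegative weights only, whereas affine
    independence and unimodularity concern coefficients of any sign with sum 0. A large constant
    added to all the coefficients of a cell makes them positive, so combinations are handled with an
    arbitrary coefficient sum [c] instead of [c = 1]; the greedy step, which lowers this sum, needs
    the same generality. The sum also determines the flow on the added arcs, so that no information
    is lost when a flow is projected to the arcs of [G]. *)

Section ClampTiling.
Variable R : realFieldType.

(** The length of the part of [[0, m]] below [t], when [0 <= m]. *)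
Definition clamp (m t : R) : R := Num.min (Num.max t 0) m.

Lemma clamp_lt0 m t : 0 <= m -> t <= 0 -> clamp m t = 0.
Proof. by move=> m0 t0; rewrite /clamp (max_r t0) (min_l m0). Qed.

Lemma clamp_id m t : 0 <= t -> t <= m -> clamp m t = t.
Proof. by move=> t0 tm; rewrite /clamp (max_l t0) (min_l tm). Qed.

Lemma clamp_gt m t : 0 <= m -> m <= t -> clamp m t = m.
Proof. by move=> m0 mt; rewrite /clamp (max_l (le_trans m0 mt)) (min_r mt). Qed.

Lemma clampD (a b t : R) : 0 <= a -> 0 <= b ->
  clamp (a + b) t = clamp a t + clamp b (t - a).
Proof.
move=> a0 b0; have [t0|t0] := leP t 0; first by rewrite !clamp_lt0; lra.
have [ta|ta] := leP t a.
  by rewrite [clamp b _]clamp_lt0 ?clamp_id; lra.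
have [tb|tb] := leP t (a + b).
  by rewrite [clamp a _]clamp_gt ?clamp_id; lra.
by rewrite !clamp_gt; lra.
Qed.

(* The length of the part of [[l, h]] below [t]. *)
Definition overlap (l h t : R) : R := Num.max 0 (Num.min t h - l).
Lemma overlap0 l h t : t <= l \/ h <= l -> overlap l h t = 0.
Proof. by move=> le; rewrite /overlap max_l // subr_le0 ge_min; case: le => ->; rewrite ?orbT. Qed.
Lemma overlap_min l h t : l <= t -> l <= h -> overlap l h t = Num.min t h - l.
Proof. by move=> lt lh; rewrite /overlap max_r // subr_ge0 le_min lt. Qed.
(** Passing a vertex translates an interval by [d] and clips it to [[0, m]]. The part of the result
    below [t] can be measured before the move, as a difference of two overlaps. *)
Lemma overlap_cut (l h d m t : R) : 0 <= m ->
  overlap (Num.max (l + d) 0) (Num.min (h + d) m) t =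
  overlap l h (clamp m t - d) - overlap l h (- d).
Proof.
move=> m0.
have [ch cm] : 0 <= clamp m t /\ clamp m t <= m.
  by rewrite /clamp le_min m0 andbT le_max lexx orbT ge_min lexx orbT.
have [hl|lh] := leP h l.
  rewrite ![overlap l h _]overlap0 ?subrr; try by right.
  apply: overlap0; right; rewrite le_max ge_min; apply/orP; left; apply/orP; left; lra.
have [t0|t0] := leP t 0.
  have -> : clamp m t = 0 by rewrite /clamp (max_r t0) min_l.
  by rewrite sub0r subrr overlap0 //; left; rewrite le_max t0 orbT.
have -> : overlap (Num.max (l + d) 0) (Num.min (h + d) m) t =
    overlap (Num.max (l + d) 0) (h + d) (clamp m t).
  by rewrite /overlap /clamp (max_l (ltW t0)) minAC minA [in RHS]minAC -!minA; congr (Num.max _ (Num.min _ _ - _)); rewrite minC.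
move: (clamp m t) ch => c c0 {t t0 cm m0 m}.
have [ld|ld] := leP (l + d) 0; last first.
  rewrite [overlap l h (- d)]overlap0 ?subr0; last by left; lra.
  by rewrite /overlap -[c in LHS](subrK d) -addr_minl opprD addrACA subrr addr0.
have [hd|hd] := leP (h + d) 0.
  rewrite overlap0; last by right.
  rewrite /overlap ![Num.min _ h]min_r ?subrr //; lra.
rewrite overlap_min // ?(ltW hd) // subr0.
rewrite !overlap_min; try lra.
rewrite [Num.min (- d) h]min_l; last lra.
by have [?|?] := leP c (h + d); [rewrite min_l|rewrite min_r]; lra.
Qed.

Lemma overlap_clamp m t : 0 <= m -> overlap 0 m t = clamp m t.
Proof. by move=> m0; rewrite /overlap subr0 /clamp maxC max_minl (max_l m0). Qed.

Lemma clampB (l h m : R) : l <= h -> 0 <= m ->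
  Num.max 0 (Num.min h m - Num.max l 0) = clamp m h - clamp m l.
Proof.
move=> lh m0; have [h0|h0] := leP h 0.
  rewrite !clamp_lt0 // ?(le_trans lh) // subrr max_l // subr_le0.
  by rewrite ge_min (le_trans h0) // le_max lexx orbT.
have [ml|lm] := leP m l.
  rewrite !clamp_gt ?(le_trans ml) // subrr max_l // subr_le0.
  by rewrite ge_min orbC (le_trans ml) // le_max lexx.
rewrite /clamp (max_l (ltW h0)) [Num.min (Num.max l 0) m]min_l; last first.
  by rewrite ge_max m0 (ltW lm).
by rewrite max_r // subr_ge0 ge_max !le_min lh m0 (ltW lm) (ltW h0).
Qed.

Variables (T : finType) (D : {pred T}) (lt : rel T).
Hypothesis ltP : strict_total_order_on D lt.

Lemma strict_max (S : {set T}) : S \subset D -> S != set0 ->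
  exists2 m, m \in S & {in S, forall e, e != m -> lt e m}.
Proof.
case: ltP => irr tr tot /subsetP SD /set0Pn [x0 x0S].
(* The largest element is the one with the most predecessors. *)
pose c e := #|[set e' in S | lt e' e]|.
case: (@arg_maxnP _ x0 (fun e => e \in S) c x0S) => m mS mmax.
exists m => // e eS em.
have /orP[//|lme] := tot _ _ (SD _ eS) (SD _ mS) em.
have : (c e <= c m)%N by apply: mmax.
rewrite /c leqNgt => /negP[]; apply/proper_card/properP; split.
  apply/subsetP => z; rewrite !inE => /andP[zS zm].
  by rewrite zS; apply: (tr m); rewrite ?SD.
by exists m; rewrite !inE mS ?lme // irr ?SD.
Qed.

(* Laying the intervals of length [f e] end to end, in the order [lt], tiles [0, \sum f]. *)
Lemma clamp_tiling (f : T -> R) t : {in D, forall e, 0 <= f e} ->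
  \sum_(e in D) clamp (f e) (t - \sum_(e' in D | lt e' e) f e') =
  clamp (\sum_(e in D) f e) t.
Proof.
move=> f0.
suff H n (S : {set T}) : #|S| = n -> S \subset D ->
  \sum_(e in S) clamp (f e) (t - \sum_(e' in S | lt e' e) f e') =
  clamp (\sum_(e in S) f e) t.
  pose S := [set e in D].
  have SE : S =i D by move=> e; rewrite inE.
  have DE : D =i S by move=> e; rewrite inE.
  have SD : S \subset D by apply/subsetP => e; rewrite -DE.
  rewrite (eq_bigl _ _ DE) [in RHS](eq_bigl _ _ DE) -(H _ S erefl SD).
  apply: eq_bigr => e _; congr (clamp _ (_ - _)).
  by apply: eq_bigl => e'; rewrite DE.
elim: n S => [|n IH] S.
  move=> /eqP; rewrite cards_eq0 => /eqP -> _; rewrite !big_set0.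
  by rewrite /clamp min_r // le_max lexx orbT.
move=> cS SD; have [|m mS mmax] := strict_max SD; first by rewrite -cards_eq0 cS.
have [irr tr tot] := ltP.
have mD := subsetP SD _ mS.
have S'D : S :\ m \subset D by apply: subset_trans SD; rewrite subsetDl.
have f0S' : 0 <= \sum_(e in S :\ m) f e.
  by apply: sumr_ge0 => e /(subsetP S'D) /f0.
(* The largest element [m] is laid last, starting where all the others end; [clampD] splits it
   off. *)
rewrite (big_setD1 m mS) [in RHS](big_setD1 m mS) /= addrC [f m + _]addrC clampD ?f0 //.
rewrite -IH //; last by move: cS; rewrite (cardsD1 m S) mS => -[].
congr (_ + _).
  apply: eq_bigr => e; rewrite in_setD1 => /andP[em eS].
  congr (clamp _ (_ - _)); apply: eq_bigl => e'; rewrite in_setD1.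
  have [->|//] := eqVneq e' m; rewrite mS /=; apply/negP => me.
  have eD := subsetP SD _ eS.
  by have := irr _ mD; rewrite (tr e _ _ eD mD mD me (mmax _ eS em)).
congr (clamp _ (_ - _)); apply: eq_bigl => e'; rewrite in_setD1.
have [->|em] := eqVneq e' m; first by rewrite irr // andbF.
by case: (boolP (e' \in S)) => //= /mmax ->.
Qed.

Lemma stack_lt (f : T -> R) e e' : {in D, forall e, 0 <= f e} ->
  e \in D -> e' \in D -> lt e e' ->
  \sum_(x in D | lt x e) f x + f e <= \sum_(x in D | lt x e') f x.
Proof.
case: ltP => irr tr tot f0 eD e'D ee'.
rewrite [leRHS](bigD1 e) ?eD ?ee' //= [leLHS]addrC lerD2l.
rewrite [leLHS]big_mkcond [leRHS]big_mkcond /=; apply: ler_sum => x _.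
case: (boolP (x \in D)) => //= xD; have [xe|_] := boolP (lt x e).
  rewrite (tr e _ _ eD xD e'D xe ee') /=.
  by have [xe'|//] := eqVneq x e; move: xe; rewrite xe' irr.
by case: ifP => // _; apply: f0.
Qed.

Lemma stack_le (f : T -> R) e : {in D, forall e, 0 <= f e} -> e \in D ->
  \sum_(x in D | lt x e) f x + f e <= \sum_(x in D) f x.
Proof.
case: ltP => irr tr tot f0 eD.
rewrite [leRHS](bigD1 e) ?eD //= [leLHS]addrC lerD2l.
rewrite [leLHS]big_mkcond [leRHS]big_mkcond /=; apply: ler_sum => x _.
case: (boolP (x \in D)) => //= xD; have [xe|_] := boolP (lt x e).
  by have [xe'|//] := eqVneq x e; move: xe; rewrite xe' irr.
by case: ifP => // _; apply: f0.
Qed.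

End ClampTiling.

(** * Uniqueness of monotone couplings with given marginals *)

Section CouplingUniqueness.
Variables (R : realFieldType) (I J : eqType).

Lemma exists_min_seq (K : eqType) (s : seq K) (P : pred K) (key : K -> R) :
  has P s ->
  exists i, [/\ i \in s, P i & forall j, j \in s -> P j -> key i <= key j].
Proof.
elim: s => //= k s IH; have [/IH[i [si Pi imin]] _|sP] := boolP (has P s).
  have [ki|ki] := boolP (P k && (key k <= key i)).
    case/andP: ki => Pk ki; exists k; split; rewrite ?mem_head // => j.
    by rewrite inE => /predU1P[->//|js /imin]; move=> /(_ js)/(le_trans ki).
  exists i; split; rewrite ?inE ?si ?orbT // => j.
  rewrite inE => /predU1P[->|js Pj]; last exact: imin.
  by move=> Pk; move: ki; rewrite Pk /= -ltNge => /ltW.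
rewrite orbF => Pk; exists k; split; rewrite ?mem_head // => j.
by rewrite inE => /predU1P[->//|js Pj]; case/hasP: sP; exists j.
Qed.

Variables (rows : seq I) (cols : seq J) (x : I -> R) (y : J -> R).
Hypotheses (urows : uniq rows) (ucols : uniq cols).

(** Only positive entries are constrained, so a row or column of weight zero, whose interval is
    empty, may share the key of another one. *)
Definition monotone_coupling (a : I -> J -> R) :=
  [/\ forall i j, i \in rows -> j \in cols -> 0 <= a i j &
      forall i i' j j', i \in rows -> i' \in rows -> j \in cols -> j' \in cols ->
        i != i' -> j != j' -> 0 < a i j' -> 0 < a i' j ->
        x i <= x i' -> y j <= y j' -> False].

Lemma exists_excess (K : eqType) (s : seq K) (a b : K -> R) k : uniq s -> k \in s ->
  \sum_(i <- s) a i = \sum_(i <- s) b i -> a k < b k ->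
  exists i, [/\ i \in s, i != k & b i < a i].
Proof.
move=> us ks; rewrite !(bigD1_seq k) //= => eqs ltk.
have [/hasP[i si /andP[ik lt]]|/hasPn nex] := boolP (has (fun i => (i != k) && (b i < a i)) s).
  by exists i.
suff : \sum_(i <- s | i != k) a i <= \sum_(i <- s | i != k) b i.
  by move: eqs ltk => /= eqs ltk; lra.
rewrite big_seq_cond [leRHS]big_seq_cond; apply: ler_sum => i /andP[si ik].
by have := nex i si; rewrite ik /= -leNgt.
Qed.

(** In the first row where the couplings differ, take the first column where they differ. The
    coupling that is smaller at this entry must exceed the other one further along the row and
    further along the column, and these two positive entries cross. *)
Lemma monotone_coupling_uniq (a b : I -> J -> R) :
  monotone_coupling a -> monotone_coupling b ->
  {in rows, forall i, \sum_(j <- cols) a i j = \sum_(j <- cols) b i j} ->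
  {in cols, forall j, \sum_(i <- rows) a i j = \sum_(i <- rows) b i j} ->
  {in rows & cols, a =2 b}.
Proof.
move=> ma mb rs cs i j ir jc; apply/eqP/negPn/negP => abij.
pose D i := has (fun j => a i j != b i j) cols.
have [|{}i [{abij}ir Di imin]] := @exists_min_seq _ rows D x.
  by apply/hasP; exists i => //; apply/hasP; exists j.
have [{}j [{jc}jc abij jmin]] := exists_min_seq y Di.
have key (c d : I -> J -> R) : monotone_coupling c -> monotone_coupling d ->
   {in rows, forall i, \sum_(j <- cols) c i j = \sum_(j <- cols) d i j} ->
   {in cols, forall j, \sum_(i <- rows) c i j = \sum_(i <- rows) d i j} ->
   (forall i' j', i' \in rows -> j' \in cols -> c i' j' != d i' j' -> x i <= x i') ->
   (forall j', j' \in cols -> c i j' != d i j' -> y j <= y j') ->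
   c i j < d i j -> False.
  move=> [c0 cm] [d0 _] rcd ccd xmin ymin cd.
  have [j' [j'c j'j lt1]] := exists_excess ucols jc (rcd _ ir) cd.
  have [i' [i'r i'i lt2]] := exists_excess urows ir (ccd _ jc) cd.
  apply: (cm i i' j j'); rewrite 1?[_ == i']eq_sym 1?[_ == j']eq_sym //.
  - exact: le_lt_trans (d0 _ _ ir j'c) lt1.
  - exact: le_lt_trans (d0 _ _ i'r jc) lt2.
  - by apply: (xmin i' j) => //; rewrite gt_eqF.
  - by apply: ymin => //; rewrite gt_eqF.
move: (abij); rewrite neq_lt => /orP[]; apply: key => //.
- by move=> i' j' i'r j'c ne; apply: imin => //; apply/hasP; exists j'.
- by move=> k kr; rewrite rs.
- by move=> k kr; rewrite cs.
- move=> i' j' i'r j'c ne; apply: imin => //; apply/hasP; exists j' => //.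
  by rewrite eq_sym.
- by move=> j' j'c ne; apply: jmin => //; rewrite eq_sym.
Qed.

End CouplingUniqueness.

(** * Hall's theorem with capacities *)

Section HallCapacities.
Variables (X Y : finType) (cap : Y -> nat).

Definition neighbours (E : {set X * Y}) (S : {set X}) : {set Y} :=
  [set y | [exists x in S, (x, y) \in E]].

Definition hall (E : {set X * Y}) :=
  [forall S : {set X}, #|S| <= \sum_(y in neighbours E S) cap y]%N.

Lemma neighboursP (E : {set X * Y}) (S : {set X}) y : reflect (exists2 x, x \in S & (x, y) \in E) (y \in neighbours E S).
Proof. by rewrite inE; apply: exists_inP. Qed.

Lemma leq_cap (U W : {set Y}) : U \subset W ->
  (\sum_(y in U) cap y <= \sum_(y in W) cap y)%N.
Proof.
move=> /subsetP UW; rewrite [leqRHS](big_setID U) /=.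
suff -> : W :&: U = U by rewrite leq_addr.
by apply/setP => y; rewrite inE; case: (boolP (y \in U)) => [/UW->|]; rewrite ?andbF.
Qed.

Lemma cap_setUI (U W : {set Y}) :
  (\sum_(y in U :|: W) cap y + \sum_(y in U :&: W) cap y =
   \sum_(y in U) cap y + \sum_(y in W) cap y)%N.
Proof.
rewrite [X in (X + _ = _)%N](big_setID U) [X in (_ = _ + X)%N](big_setID U) /=.
have -> : (U :|: W) :&: U = U by rewrite setUK.
have -> : (U :|: W) :\: U = W :\: U by rewrite setDUl setDv set0U.
by rewrite [W :&: U]setIC; lia.
Qed.

(** A set that violates Hall's condition once [(x, y)] is removed must contain [x], since otherwise
    its neighbours have not changed. The set [S] is what remains of it without [x]. *)
Lemma hall_min_tight (E : {set X * Y}) x y : hall E -> (x, y) \in E ->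
  ~~ hall (E :\ (x, y)) ->
  exists S : {set X}, [/\ x \notin S &
    (\sum_(z in neighbours E S :|: [set z | ((x, z) \in E) && (z != y)]) cap z <= #|S|)%N].
Proof.
move=> hE xyE /forallPn[S]; rewrite -ltnNge => ltS.
have xS : x \in S.
  apply/negPn/negP => xS; move: ltS; rewrite ltnNge => /negP[].
  apply: leq_trans (forallP hE S) _; apply: leq_cap.
  apply/subsetP => z /neighboursP[x' x'S x'z]; apply/neighboursP; exists x' => //.
  rewrite in_setD1 x'z andbT xpair_eqE negb_and; apply/orP; left.
  by apply: contraNneq xS => <-.
exists (S :\ x); rewrite setD11; split => //.
have := cardsD1 x S; rewrite xS => cS.
apply: leq_trans (_ : #|S|.-1 <= _)%N; last by rewrite cS.
rewrite -ltnS prednK ?cS //; move: (ltS); rewrite cS; apply: leq_ltn_trans; apply: leq_cap.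
apply/subsetP => z; rewrite !inE => /orP[/exists_inP[x' ]|/andP[xz zy]].
  rewrite in_setD1 => /andP[x'x x'S] x'z; apply/exists_inP; exists x' => //.
  by rewrite in_setD1 x'z andbT xpair_eqE (negbTE x'x).
by apply/exists_inP; exists x => //; rewrite in_setD1 xz andbT xpair_eqE (negbTE zy) andbF.
Qed.

(* Rado's proof: in an inclusion-minimal edge set satisfying Hall's condition, every vertex of [X] has degree 1. *)
Lemma hall_capacities (E : {set X * Y}) : hall E ->
  exists h : X -> Y, (forall x, (x, h x) \in E) /\
    forall y, (#|[set x | h x == y]| <= cap y)%N.
Proof.
elim/(well_founded_ind (Wf_nat.well_founded_ltof _ (fun E : {set X * Y} => #|E|))): E.
move=> E IH hE.
have [/existsP[p /andP[pE hp]]|/existsPn minE] := boolP [exists p, (p \in E) && hall (E :\ p)].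
  have [|h [h1 h2]] := IH (E :\ p) _ hp.
    by rewrite /Wf_nat.ltof (cardsD1 p E) pE; apply/ssrnat.ltP; rewrite add1n.
  by exists h; split => // x; have := h1 x; rewrite in_setD1 => /andP[].
have deg1 x : exists y, (x, y) \in E.
  have := forallP hE [set x]; rewrite cards1.
  have [y yN _|N0] := pickP (mem (neighbours E [set x])); last by rewrite big_pred0.
  by have /neighboursP[x' /set1P-> xy] := yN; exists y.
have uniq_nb x y1 y2 : (x, y1) \in E -> (x, y2) \in E -> y1 = y2.
  move=> e1 e2; apply/eqP/negPn/negP => y12.
  have := minE (x, y1); rewrite e1 /= => n1; have := minE (x, y2); rewrite e2 /= => n2.
  have [S1 [xS1 c1]] := hall_min_tight hE e1 n1.
  have [S2 [xS2 c2]] := hall_min_tight hE e2 n2.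
  set U1 := (X in X :|: _) in c1; set U2 := (X in X :|: _) in c2.
  set W1 := (X in U1 :|: X) in c1; set W2 := (X in U2 :|: X) in c2.
  (* Capacity is modular. As [y1 != y2], the union of the two tight neighbourhoods contains all
     neighbours of [x |: (S1 :|: S2)], and their intersection contains those of [S1 :&: S2]. Hall's
     condition for these two sets asks for one unit more than is available. *)
  have a1 := forallP hE (x |: (S1 :|: S2)); have a2 := forallP hE (S1 :&: S2).
  have s1 : neighbours E (x |: (S1 :|: S2)) \subset (U1 :|: W1) :|: (U2 :|: W2).
    apply/subsetP => z /neighboursP[x']; rewrite in_setU1 in_setU.
    case/or3P => [/eqP-> xz|x'S x'z|x'S x'z]; rewrite !inE.
    - rewrite xz /=; have [->|_] := eqVneq z y1; last by rewrite /= !orbT.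
      by rewrite y12 /= !orbT.
    - by apply/orP; left; apply/orP; left; apply/exists_inP; exists x'.
    - by apply/orP; right; apply/orP; left; apply/exists_inP; exists x'.
  have s2 : neighbours E (S1 :&: S2) \subset (U1 :|: W1) :&: (U2 :|: W2).
    apply/subsetP => z /neighboursP[x']; rewrite in_setI => /andP[i1 i2] x'z.
    by rewrite !inE; apply/andP; split; apply/orP; left; apply/exists_inP; exists x'.
  have := leq_cap s1; have := leq_cap s2; have := cap_setUI (U1 :|: W1) (U2 :|: W2).
  have := cardsUI S1 S2; move: a1 a2; rewrite cardsU1 !inE (negbTE xS1) (negbTE xS2) /=.
  by move: c1 c2; lia.
have [h hP] := fin_all_exists deg1.
exists h; split => // y.
(* Hall's condition is applied to the fibre of [y], whose only possible neighbour is [y]. *)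
apply: leq_trans (forallP hE _) _.
apply: leq_trans (_ : \sum_(z in [set y]) cap z <= _)%N; last by rewrite big_set1.
apply: leq_cap; apply/subsetP => z /neighboursP[x]; rewrite inE => /eqP hx xz.
by rewrite inE -hx (uniq_nb x _ _ xz (hP x)).
Qed.

End HallCapacities.

(** * Path weights of a flow on a framed acyclic graph *)

Section FramedPaths.
(* [hd e = None] for the arcs ending at a sink and [tl e = None] for those leaving a source; the relations [ilt v], [olt v] frame the vertex [v]. *)
Variables (V E : finType) (hd tl : E -> option V) (ilt olt : V -> rel E).
Variable rk : E -> nat.
Hypothesis iltP : forall v, strict_total_order_on [pred e | hd e == Some v] (ilt v).
Hypothesis oltP : forall v, strict_total_order_on [pred e | tl e == Some v] (olt v).
Hypothesis rkP : forall e g v, hd e = Some v -> tl g = Some v -> (rk e < rk g)%N.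

(* Paths are listed backwards: the head of the list is the last arc. *)
Fixpoint xpath (s : seq E) : bool :=
  match s with
  | [::] => false
  | g :: s' => if s' is e :: _ then [&& tl g != None, hd e == tl g & xpath s']
               else tl g == None
  end.

Lemma xpath_cons g e s :
  xpath [:: g, e & s] = [&& tl g != None, hd e == tl g & xpath (e :: s)].
Proof. by []. Qed.

Lemma xpath_consS v g e s : tl g = Some v ->
  xpath [:: g, e & s] = (hd e == Some v) && xpath (e :: s).
Proof. by move=> tg; rewrite xpath_cons tg. Qed.

Lemma xpath1 g : xpath [:: g] = (tl g == None). Proof. by []. Qed.

(** The paths from a source with last arc [g]. Going back by one arc lowers the rank, so any fuel
    above [rk g] gives them all. *)
Fixpoint xps n g : seq (seq E) :=
  if n is n'.+1 then
    if tl g is Some v then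
      flatten [seq [seq g :: s | s <- xps n' e] | e <- enum [pred e | hd e == Some v]]
    else [:: [:: g]]
  else [::].

Definition xp g := xps (rk g).+1 g.

Lemma xps_fuel n m g : (rk g < n)%N -> (rk g < m)%N -> xps n g = xps m g.
Proof.
elim: n m g => [|n IH] [|m] g //=; rewrite !ltnS => gn gm.
case tg: (tl g) => [v|//]; congr flatten; apply/eq_in_map => e.
rewrite mem_enum inE => /eqP he; have lt := rkP he tg; congr map.
by apply: IH; apply: leq_trans lt _.
Qed.

Lemma xpE g v : tl g = Some v ->
  xp g = flatten [seq [seq g :: s | s <- xp e] | e <- enum [pred e | hd e == Some v]].
Proof.
move=> tg; rewrite {1}/xp /= tg; congr flatten; apply/eq_in_map => e.
rewrite mem_enum inE => /eqP he; have lt := rkP he tg; congr map.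
exact: xps_fuel.
Qed.

Lemma xpN g : tl g = None -> xp g = [:: [:: g]].
Proof. by move=> tg; rewrite /xp /= tg. Qed.

Lemma rk_ind (P : E -> Prop) :
  (forall g, (forall e, (rk e < rk g)%N -> P e) -> P g) -> forall g, P g.
Proof.
move=> H g; have [n le] := ubnP (rk g); elim: n g le => // n IH g le.
by apply: H => e lt; apply: IH; apply: leq_trans lt _.
Qed.

Lemma mem_xp g s : (s \in xp g) = xpath s && (ohead s == Some g).
Proof.
elim/rk_ind: g s => g IH s; case tg: (tl g) => [v|]; last first.
  rewrite xpN // inE; case: s => [|g' [|e s]]; first by rewrite andbF.
    rewrite xpath1; apply/eqP/andP => [[->]|[_ /eqP[->]//]].
    by rewrite tg.
  rewrite xpath_cons /=; apply/idP/idP => [/eqP//|/andP[/and3P[t _ _] /eqP[e1]]].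
  by move: t; rewrite e1 tg.
rewrite (xpE tg); apply/flattenP/andP => [[t /mapP[e + ->]]|].
  rewrite mem_enum inE => /eqP he /mapP[s' s'e ->]; split=> //=.
  move: s'e; rewrite IH ?(rkP he tg) // => /andP[].
  by case: s' => // e' s' xs /eqP[e'E]; rewrite -/(xpath (e' :: s')) xs e'E he tg eqxx.
case=> xs /eqP; case: s xs => // g' [|e s].
  by rewrite xpath1 => /eqP t [e1]; rewrite e1 tg in t.
rewrite xpath_cons => /and3P[_ /eqP he xs] [e1]; move: he; rewrite e1 tg => he.
exists [seq g :: s | s <- xp e].
  by apply: map_f; rewrite mem_enum inE he.
by apply: map_f; rewrite IH ?(rkP he tg) // xs /= eqxx.
Qed.

Lemma big_xp (M : nmodType) (phi : seq E -> M) g v : tl g = Some v ->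
  \sum_(s <- xp g) phi s =
  \sum_(e | hd e == Some v) \sum_(s <- xp e) phi (g :: s).
Proof.
move=> tg; rewrite (xpE tg) big_flatten big_map big_enum /=.
by apply: eq_bigr => e _; rewrite big_map.
Qed.

(* [into None] lists the complete source-to-sink paths. *)
Definition into o := flatten [seq xp e | e <- enum [pred e | hd e == o]].

Lemma xp_into g v : tl g = Some v -> xp g = [seq g :: s | s <- into (Some v)].
Proof. by move=> tg; rewrite (xpE tg) map_flatten -map_comp. Qed.

Lemma uniq_into_aux o : (forall e, hd e = o -> uniq (xp e)) -> uniq (into o).
Proof.
have : {in enum [pred e | hd e == o], forall e, hd e = o}.
  by move=> e; rewrite mem_enum inE => /eqP.
rewrite /into; elim: (enum _) (enum_uniq [pred e | hd e == o]) => //= e es IH.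
move=> /andP[ees ues] ho uo.
rewrite cat_uniq uo ?IH ?andbT //=; last by apply: ho; rewrite mem_head.
  by apply/hasPn => s /flattenP[t /mapP[e' e'es ->]]; rewrite !mem_xp => /andP[_ /eqP se'];
     rewrite se' andbC; apply: contraNN ees => /andP[/eqP[<-]].
by move=> e' e'es; apply: ho; rewrite inE e'es orbT.
Qed.

Lemma uniq_xp g : uniq (xp g).
Proof.
elim/rk_ind: g => g IH; case tg: (tl g) => [v|]; last by rewrite xpN.
rewrite (xp_into tg) map_inj_uniq => [|? ? []//]; apply: uniq_into_aux => e he.
exact: IH (rkP he tg).
Qed.

Lemma uniq_into o : uniq (into o).
Proof. by apply: uniq_into_aux => e _; apply: uniq_xp. Qed.

Lemma mem_into o s : (s \in into o) = xpath s && (if s is e :: _ then hd e == o else false).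
Proof.
apply/flattenP/andP => [[t /mapP[e + ->]]|[]].
  by rewrite mem_enum inE mem_xp => he /andP[]; case: s => // e' s -> /eqP[->].
case: s => // e s xs he; exists (xp e); last by rewrite mem_xp xs /=.
by apply: map_f; rewrite mem_enum inE.
Qed.

(** As lists run backwards, the maximal common final subpath of two paths is the longest common
    prefix of their lists. *)
Fixpoint rin_lt (s1 s2 : seq E) : bool :=
  if (s1, s2) is (e1 :: t1, e2 :: t2) then
    if e1 == e2 then rin_lt t1 t2
    else if hd e1 is Some v then ilt v e1 e2 else false
  else false.

(** Both paths begin at a source, so neither is a proper final part of the other, and the comparison
    reaches two different arcs with the same head. *)
Lemma rin_lt_total v e1 e2 s1 s2 : xpath (e1 :: s1) -> xpath (e2 :: s2) ->
  hd e1 = Some v -> hd e2 = Some v -> e1 :: s1 != e2 :: s2 ->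
  rin_lt (e1 :: s1) (e2 :: s2) || rin_lt (e2 :: s2) (e1 :: s1).
Proof.
elim: s1 v e1 e2 s2 => [|e1' s1 IH] v e1 e2 s2 x1 x2 h1 h2 ne; rewrite /= [e1 == e2]eq_sym.
all: have [e21|ne12] := eqVneq e2 e1; last first.
1,3: by rewrite h1 h2; have [_ _ tot] := iltP v; apply: tot; rewrite ?inE ?h1 ?h2 // eq_sym.
- rewrite e21 in x2 ne; case: s2 x2 ne => [|e2' s2]; first by rewrite eqxx.
  by rewrite xpath_cons => /andP[]; rewrite xpath1 in x1; rewrite x1.
- rewrite e21 in x2 ne; case: s2 x2 ne => [|e2' s2].
    by rewrite xpath1 => t; move: x1; rewrite xpath_cons t.
  rewrite xpath_cons eqseq_cons eqxx /= => /and3P[t /eqP h2' x2] ne.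
  move: x1; rewrite xpath_cons => /and3P[_ /eqP h1' x1].
  by case: (tl e1) t h2' h1' => // v' _ h2' h1'; apply: (IH v').
Qed.

(** * The path intervals of a fixed flow *)

Section Flow.
Variables (R : realFieldType) (f : E -> R).
Hypothesis f0 : forall e, 0 <= f e.
Hypothesis conserved : forall v,
  \sum_(e in [pred e | hd e == Some v]) f e = \sum_(e in [pred e | tl e == Some v]) f e.

(** The left end of the interval of [e] in the tiling at [v] by the entering arcs; [outpos] plays
    this role for the leaving arcs. *)
Definition inpos v e := \sum_(x in [pred x | hd x == Some v] | ilt v x e) f x.
Definition outpos v e := \sum_(x in [pred x | tl x == Some v] | olt v x e) f x.

(* At [v], the incoming arcs and the outgoing arcs each tile the interval [0, flow through v]; [ivl s] is the part of the last arc of [s] whose particles have followed [s]. *)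
Fixpoint ivl (s : seq E) : R * R :=
  match s with
  | [::] => (0, 0)
  | g :: s' =>
    if (s', tl g) is (e :: _, Some v) then
      (Num.max ((ivl s').1 + inpos v e - outpos v g) 0,
       Num.min ((ivl s').2 + inpos v e - outpos v g) (f g))
    else (0, f g)
  end.

Definition pathweight s := Num.max 0 ((ivl s).2 - (ivl s).1).
Definition pathmass s t := overlap (ivl s).1 (ivl s).2 t.

Lemma ivl_cons g e s v : tl g = Some v -> ivl [:: g, e & s] =
  (Num.max ((ivl (e :: s)).1 + inpos v e - outpos v g) 0,
   Num.min ((ivl (e :: s)).2 + inpos v e - outpos v g) (f g)).
Proof. by move=> tg; rewrite [LHS]/= tg. Qed.

Lemma ivl_ge0 s : 0 <= (ivl s).1.
Proof.
case: s => [|g [|e s]] /=; first exact: lexx.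
  by [].
by case: (tl g) => [v|] //=; rewrite le_max lexx orbT.
Qed.

Lemma ivl_le g s : (ivl (g :: s)).2 <= f g.
Proof.
case: s => [|e s] /=; first by case: (tl g).
by case: (tl g) => [v|] //=; rewrite ge_min lexx orbT.
Qed.

Lemma ivl1 g : ivl [:: g] = (0, f g).
Proof. by []. Qed.

#[local] Arguments ivl : simpl never.

Lemma outpos_le v g : tl g = Some v ->
  outpos v g + f g <= \sum_(e in [pred e | tl e == Some v]) f e.
Proof. by move=> tg; apply: (stack_le (oltP v)) => //; rewrite inE tg. Qed.

Lemma inpos_le v g : hd g = Some v ->
  inpos v g + f g <= \sum_(e in [pred e | tl e == Some v]) f e.
Proof. by rewrite -conserved => tg; apply: (stack_le (iltP v)) => //; rewrite inE tg. Qed.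

Lemma outpos_ge0 v g : 0 <= outpos v g.
Proof. exact: sumr_ge0. Qed.

Lemma inpos_ge0 v g : 0 <= inpos v g.
Proof. exact: sumr_ge0. Qed.

Lemma pathmass_cons g e s v t : tl g = Some v ->
  pathmass [:: g, e & s] t =
  pathmass (e :: s) (clamp (f g) t + outpos v g - inpos v e)
  - pathmass (e :: s) (outpos v g - inpos v e).
Proof.
move=> tg; rewrite /pathmass (ivl_cons _ _ tg) /= -!addrA overlap_cut //.
by rewrite !opprB.
Qed.

(** Total lengths alone would not support the induction: one step back through the vertex turns
    [[0, t]] on the arc [g] into cuts at arbitrary points of the arcs entering that vertex. *)
Lemma sum_pathmass g t : \sum_(s <- xp g) pathmass s t = clamp (f g) t.
Proof.
elim/rk_ind: g t => g IH t; case tg: (tl g) => [v|]; last first.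
  by rewrite xpN // big_seq1 /pathmass ivl1 /= overlap_clamp.
rewrite (big_xp _ tg).
transitivity (\sum_(e | hd e == Some v) (clamp (f e) (clamp (f g) t + outpos v g - inpos v e)
    - clamp (f e) (outpos v g - inpos v e))).
  apply: eq_bigr => e /eqP he; rewrite -!(IH e (rkP he tg)) -sumrB !big_seq.
  apply: eq_bigr => s; rewrite mem_xp; case: s => // e' s /andP[_ /eqP[->]].
  exact: pathmass_cons.
have [a0 b0] := (outpos_ge0 v g, outpos_le tg).
rewrite sumrB.
have tile u : \sum_(e | hd e == Some v) clamp (f e) (u - inpos v e) =
    clamp (\sum_(e in [pred e | tl e == Some v]) f e) u.
  by rewrite -conserved -(clamp_tiling (iltP v)).
have c0 : 0 <= clamp (f g) t <= f g.
  by rewrite /clamp ge_min lexx orbT andbT le_min f0 andbT le_max lexx orbT.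
rewrite !tile; move: (clamp (f g) t) c0 => c /andP[c0 cf].
by rewrite !clamp_id; lra.
Qed.

Lemma pathweight_ge0 s : 0 <= pathweight s.
Proof. by rewrite /pathweight le_max lexx. Qed.

Lemma pathweight_cons_le g e s : tl g != None ->
  pathweight [:: g, e & s] <= pathweight (e :: s).
Proof.
case tg: (tl g) => [v|//] _; rewrite /pathweight (ivl_cons _ _ tg) /=.
set m := Num.min _ _; set M := Num.max (_ - _) 0.
have : m <= (ivl (e :: s)).2 + inpos v e - outpos v g by rewrite /m ge_min lexx.
have : (ivl (e :: s)).1 + inpos v e - outpos v g <= M by rewrite /M le_max lexx.
move=> Mle mle; rewrite ge_max le_max lexx /= le_max; apply/orP; right.
by lra.
Qed.

(** The interval of a path arriving at [v] lies inside the interval tiled by the leaving arcs, which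
    cut it into the intervals of its continuations. *)
Lemma sum_pathweight_cons v e s : hd e = Some v ->
  \sum_(g | tl g == Some v) pathweight [:: g, e & s] = pathweight (e :: s).
Proof.
move=> he; pose l := (ivl (e :: s)).1; pose h := (ivl (e :: s)).2.
have [l0 hf] := (ivl_ge0 (e :: s), ivl_le e s); have a0 := inpos_ge0 v e.
have aF := inpos_le he.
(* Clipping may leave the ends of an empty interval in the wrong order, and the differences of
   clamps below measure only genuine intervals. *)
have [hl|lh] := ltP h l.
  rewrite big1 => [|g /eqP tg]; first by rewrite /pathweight -/l -/h max_l //; lra.
  have ne : tl g != None by rewrite tg.
  apply/eqP; rewrite eq_le pathweight_ge0 andbT.
  by apply: le_trans (pathweight_cons_le _ _ ne) _; rewrite /pathweight ge_max lexx subr_le0 ltW.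
have tile u : \sum_(g | tl g == Some v) clamp (f g) (u - outpos v g) =
    clamp (\sum_(e in [pred e | tl e == Some v]) f e) u.
  by rewrite -(clamp_tiling (oltP v)).
transitivity (\sum_(g | tl g == Some v) (clamp (f g) (h + inpos v e - outpos v g) -
                                        clamp (f g) (l + inpos v e - outpos v g))).
  apply: eq_bigr => g /eqP tg; rewrite /pathweight (ivl_cons _ _ tg) /= -/l -/h.
  by rewrite clampB // !lerD2r.
rewrite sumrB !tile /pathweight -/l -/h max_r ?subr_ge0 //.
rewrite -/l in l0; rewrite -/h in hf.
by rewrite !clamp_id; lra.
Qed.

Lemma sum_pathweight g : \sum_(s <- xp g) pathweight s = f g.
Proof.
have <- : clamp (f g) (f g) = f g by rewrite clamp_id.
rewrite -sum_pathmass !big_seq; apply: eq_bigr => s; rewrite mem_xp.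
case: s => // e s /andP[_ /eqP[->]]; rewrite /pathweight /pathmass /overlap.
by rewrite (min_r (ivl_le _ _)).
Qed.

(** Different last arcs occupy successive intervals at [v]. On a common last arc, positions are
    those at the previous vertex up to one and the same translation, and clipping only shrinks
    intervals. *)
Lemma rin_lt_ivl v e1 e2 s1 s2 : xpath (e1 :: s1) -> xpath (e2 :: s2) ->
  hd e1 = Some v -> hd e2 = Some v -> rin_lt (e1 :: s1) (e2 :: s2) ->
  0 < pathweight (e1 :: s1) -> 0 < pathweight (e2 :: s2) ->
  (ivl (e1 :: s1)).2 + inpos v e1 <= (ivl (e2 :: s2)).1 + inpos v e2.
Proof.
elim: s1 v e1 e2 s2 => [|e1' s1 IH] v e1 e2 s2 x1 x2 h1 h2.
all: rewrite [rin_lt _ _]/=; have [e12|ne12] := eqVneq e1 e2; last first.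
1,3: rewrite h1 => lt _ _; have [? ?] := (ivl_le e1 [::], ivl_ge0 (e2 :: s2)).
1,2: have := @stack_lt R E _ _ (iltP v) f e1 e2 (fun e _ => f0 e).
1,2: rewrite !inE h1 h2 /= eqxx => /(_ isT isT lt); rewrite -!/(inpos _ _).
- by lra.
- by have := ivl_le e1 (e1' :: s1); lra.
- by [].
rewrite -e12 in x2 *; case: s2 x2 => [|e2' s2].
  by rewrite xpath1 => t; move: x1; rewrite xpath_cons t.
rewrite xpath_cons => /and3P[t /eqP h2' x2].
move: x1; rewrite xpath_cons => /and3P[_ /eqP h1' x1] lt w1 w2.
have w1' := lt_le_trans w1 (pathweight_cons_le _ _ t).
have w2' := lt_le_trans w2 (pathweight_cons_le _ _ t).
case tv: (tl e1) t h2' h1' => [v'|//] _ h2' h1'.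
have := IH v' _ _ _ x1 x2 h1' h2' lt w1' w2'.
rewrite !(ivl_cons _ _ tv) /=; set m := Num.min _ _; set M := Num.max (_ - _) 0.
have : m <= (ivl (e1' :: s1)).2 + inpos v' e1' - outpos v' e1 by rewrite /m ge_min lexx.
have : (ivl (e2' :: s2)).1 + inpos v' e2' - outpos v' e1 <= M by rewrite /M le_max lexx.
by lra.
Qed.

(** Crossings are read on paths that stop just after they separate, so that the condition is
    available before the paths are completed to routes. *)
Definition uncrossed (a : seq E -> R) := forall v e1 s1 e2 s2 g1 g2,
  xpath (e1 :: s1) -> xpath (e2 :: s2) ->
  hd e1 = Some v -> hd e2 = Some v -> tl g1 = Some v -> tl g2 = Some v ->
  rin_lt (e1 :: s1) (e2 :: s2) -> olt v g1 g2 ->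
  0 < a [:: g2, e1 & s1] -> 0 < a [:: g1, e2 & s2] -> False.

Definition splits (a : seq E -> R) := forall v e s, xpath (e :: s) ->
  hd e = Some v -> \sum_(g | tl g == Some v) a [:: g, e & s] = a (e :: s).

Definition weighting (a : seq E -> R) :=
  [/\ forall s, xpath s -> 0 <= a s, splits a,
      forall g, \sum_(s <- xp g) a s = f g & uncrossed a].

Lemma pathweight_uncrossed : uncrossed pathweight.
Proof.
move=> v e1 s1 e2 s2 g1 g2 x1 x2 h1 h2 t1 t2 rlt olt12 w1 w2.
have n1 : tl g1 != None by rewrite t1.
have n2 : tl g2 != None by rewrite t2.
have w1' := lt_le_trans w1 (pathweight_cons_le _ _ n2).
have w2' := lt_le_trans w2 (pathweight_cons_le _ _ n1).
have := rin_lt_ivl x1 x2 h1 h2 rlt w1' w2'.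
have := @stack_lt R E _ _ (oltP v) f g1 g2 (fun e _ => f0 e).
rewrite !inE t1 t2 /= eqxx => /(_ isT isT olt12); rewrite -!/(outpos _ _).
move: w1 w2; rewrite /pathweight (ivl_cons _ _ t1) (ivl_cons _ _ t2) /=.
rewrite !lt_max !ltxx /= !subr_gt0 !gt_max !lt_min.
move=> /andP[_ /andP[w1 _]] /andP[/andP[_ w2] _].
by move: w1 w2; lra.
Qed.

Lemma pathweight_weighting : weighting pathweight.
Proof.
split; [by move=> s _; apply: pathweight_ge0| |exact: sum_pathweight|exact: pathweight_uncrossed].
by move=> v e s _; apply: sum_pathweight_cons.
Qed.

(** The weighting [a] enters only through the entries of the coupling. The keys are positions
    computed from [pathweight], so [a] and [pathweight] itself give couplings monotone for the same
    keys. *)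
Lemma weighting_monotone (a : seq E -> R) v : weighting a ->
  (forall e s, hd e = Some v -> xpath (e :: s) -> a (e :: s) = pathweight (e :: s)) ->
  monotone_coupling (into (Some v)) (enum [pred g | tl g == Some v])
    (fun s => (ivl s).1 + if s is e :: _ then inpos v e else 0)
    (outpos v) (fun s g => a (g :: s)).
Proof.
move=> [a0 aS aF aC] aw.
have intoP s : s \in into (Some v) -> exists e s', [/\ s = e :: s', hd e = Some v & xpath (e :: s')].
  rewrite mem_into => /andP[]; case: s => // e s xs /eqP he.
  by exists e, s.
have xc g e s : tl g = Some v -> hd e = Some v -> xpath (e :: s) -> xpath [:: g, e & s].
  by move=> tg he xs; rewrite (xpath_consS _ _ tg) he eqxx.
have colP g : g \in enum [pred g | tl g == Some v] -> tl g = Some v.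
  by rewrite mem_enum inE => /eqP.
(* An entry is bounded by the weight of its row and by that of its column, so a positive entry
   forces both intervals to have positive length, which makes the comparison of their ends
   strict. *)
have leF g e s : tl g = Some v -> hd e = Some v -> xpath (e :: s) ->
    a [:: g, e & s] <= f g /\ a [:: g, e & s] <= pathweight (e :: s).
  move=> tg he xs; split.
    rewrite -aF (bigD1_seq [:: g, e & s]) ?uniq_xp ?mem_xp ?xc //= ?eqxx // lerDl.
    by rewrite big_seq_cond sumr_ge0 // => s' /andP[]; rewrite mem_xp => /andP[/a0].
  rewrite -aw // -(aS v e s xs he) (bigD1 g) ?tg //= lerDl.
  by apply: sumr_ge0 => g' /andP[/eqP tg' _]; apply: a0; apply: xc.
split=> [s g /intoP[e [s' [-> he xs]]] /colP tg|]; first by apply: a0; apply: xc.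
move=> s1 s2 g1 g2 /intoP[e1 [s1' [-> h1 x1]]] /intoP[e2 [s2' [-> h2 x2]]].
move=> /colP t1 /colP t2 ne12 ng12 a1 a2 le_in le_out.
have [lf1 lw1] := leF _ _ _ t2 h1 x1; have [lf2 lw2] := leF _ _ _ t1 h2 x2.
have w1 := lt_le_trans a1 lw1; have w2 := lt_le_trans a2 lw2.
have fg1 := lt_le_trans a2 lf2; have fg2 := lt_le_trans a1 lf1.
have wlt s : 0 < pathweight s -> (ivl s).1 < (ivl s).2.
  by rewrite /pathweight lt_max ltxx /= subr_gt0.
have /orP[lt12|lt21] := rin_lt_total x1 x2 h1 h2 ne12; last first.
  by have := rin_lt_ivl x2 x1 h2 h1 lt21 w2 w1; have := wlt _ w2; lra.
have [_ _ tot] := oltP v.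
have /orP[olt12|olt21] := tot g1 g2 (introT eqP t1) (introT eqP t2) ng12.
  exact: aC x1 x2 h1 h2 t1 t2 lt12 olt12 a1 a2.
have := @stack_lt R E _ _ (oltP v) f g2 g1 (fun e _ => f0 e).
rewrite !inE t1 t2 /= eqxx => /(_ isT isT olt21); rewrite -!/(outpos _ _).
by lra.
Qed.

(* At a vertex, the weights [a (g :: s)] couple the arriving paths [s], of weights known by induction, with the outgoing arcs [g], of weights [f g]; being uncrossed makes this coupling monotone. *)
Lemma weighting_uniq (a : seq E -> R) s : weighting a -> xpath s -> a s = pathweight s.
Proof.
move=> wa; case: s => // g s; elim/rk_ind: g s => g IH s xs.
have ww := pathweight_weighting.
have [_ aS aF _] := wa; have [_ wS wF _] := ww.
case tg: (tl g) => [v|]; last first.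
  have := etrans (aF g) (esym (wF g)); rewrite xpN // !big_seq1.
  by case: s xs => // e s; rewrite xpath_cons tg.
case: s xs => [|e s]; first by rewrite xpath1 tg.
rewrite (xpath_consS _ _ tg) => /andP[/eqP he xs].
have IHv e' s' : hd e' = Some v -> xpath (e' :: s') -> a (e' :: s') = pathweight (e' :: s').
  by move=> he'; apply: IH; apply: rkP he' tg.
have cE g' (b : seq E -> R) : g' \in enum [pred g | tl g == Some v] ->
    \sum_(s <- into (Some v)) b (g' :: s) = \sum_(s <- xp g') b s.
  by rewrite mem_enum inE => /eqP tg'; rewrite (xp_into tg') big_map.
have uinto := uniq_into (Some v).
have := monotone_coupling_uniq uinto (enum_uniq _)
  (weighting_monotone wa IHv) (weighting_monotone ww (fun _ _ _ _ => erefl)).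
apply=> //.
- move=> s'; rewrite mem_into; case: s' => // e' s' /andP[xs' /eqP he'].
  by rewrite !big_enum /= aS // wS // IHv.
- by move=> g' g'v; rewrite !cE // aF wF.
- by rewrite mem_into xs /= he.
- by rewrite mem_enum inE tg.
Qed.

End Flow.

(** * Weights on complete routes and their sums over prefixes and arcs *)

Section RouteWeights.
Variables (R : realFieldType) (b : seq E -> R).

(** In the backward lists, a suffix of a route is an initial part of it. *)
Definition prefix_weight s := \sum_(r <- into None | suffix s r) b r.
Definition arc_weight g := \sum_(r <- into None | g \in r) b r.

Lemma xpath_cat r s : s != [::] -> xpath (r ++ s) -> xpath s.
Proof.
move=> s0; elim: r => // g r IH; rewrite cat_cons; case rs: (r ++ s) => [|e t].
  by case: r rs {IH} => //= s0'; rewrite s0' in s0.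
by rewrite xpath_cons => /and3P[_ _]; rewrite -rs.
Qed.

Lemma xpath_adj r g e s : xpath (r ++ [:: g, e & s]) -> tl g = hd e /\ tl g != None.
Proof. by move=> /xpath_cat - /(_ isT); rewrite xpath_cons => /and3P[? /eqP]. Qed.

Lemma xpath_uniq r : xpath r -> uniq r.
Proof.
move=> xr; apply: (@sorted_uniq _ (fun e g => rk g < rk e)%N).
- by move=> a c d ca ad; apply: ltn_trans ad ca.
- by move=> a; rewrite ltnn.
elim: r xr => // g [|e s] IH //; rewrite xpath_cons => /and3P[]; case tg: (tl g) => [v|//] _.
by move=> /eqP he /IH /= ->; rewrite (rkP he tg).
Qed.

(** By acyclicity a route uses an arc at most once, so at most one of its initial parts ends with
    [g]. *)
Lemma suffix_xp (M : nmodType) g r (x : M) : xpath r ->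
  \sum_(s <- xp g | suffix s r) x = if g \in r then x else 0.
Proof.
move=> xr; have ur := xpath_uniq xr.
have sufE s : s \in xp g -> suffix s r -> s = drop (index g r) r /\ g \in r.
  rewrite mem_xp => /andP[_]; case: s => // g' s /eqP[->] /suffixP[t rt].
  rewrite rt mem_cat mem_head orbT; split=> //.
  have gt : g \notin t.
    by move: ur; rewrite rt cat_uniq => /and3P[_ /hasPn/(_ g) + _]; rewrite mem_head; apply.
  by rewrite index_cat (negbTE gt) /= eqxx addn0 drop_size_cat.
case: ifP => gr; last first.
  by rewrite big_seq_cond big1 // => s /andP[sg /(sufE _ sg)[_]]; rewrite gr.
pose s0 := drop (index g r) r.
have s0E : s0 = g :: drop (index g r).+1 r by rewrite /s0 (drop_nth g) ?index_mem // nth_index.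
have rE : r = take (index g r) r ++ s0 by rewrite cat_take_drop.
have s0x : s0 \in xp g.
  rewrite mem_xp {2}s0E eqxx andbT; apply: (@xpath_cat (take (index g r) r)); first by rewrite s0E.
  by rewrite -rE.
rewrite big_mkcond (bigD1_seq s0) ?uniq_xp //= ifT; last first.
  by apply/suffixP; exists (take (index g r) r).
rewrite big_seq_cond big1 ?addr0 // => s /andP[sg ss0]; case: ifP => // sr.
by case/eqP: ss0; have [] := sufE s sg sr.
Qed.

Lemma sum_prefix_weight g : \sum_(s <- xp g) prefix_weight s = arc_weight g.
Proof.
rewrite /prefix_weight /arc_weight (exchange_big_dep xpredT) //= [RHS]big_mkcond.
rewrite !big_seq; apply: eq_bigr => r; rewrite mem_into => /andP[xr _].
exact: suffix_xp.
Qed.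

(** A route ends at a sink, so a route that begins with a path into [v] continues by exactly one arc
    leaving [v]. *)
Lemma prefix_weight_splits : splits prefix_weight.
Proof.
move=> v e s xs he; rewrite /prefix_weight (exchange_big_dep xpredT) //= [RHS]big_mkcond.
rewrite !big_seq; apply: eq_bigr => r; rewrite mem_into => /andP[xr hr].
have [/suffixP[t rt]|nsuf] := boolP (suffix (e :: s) r); last first.
  rewrite big1 // => g /andP[_ /suffixP[t rt]]; case/negP: nsuf.
  by apply/suffixP; exists (rcons t g); rewrite cat_rcons.
case/lastP: t rt => [|t g0] rt; first by move: hr; rewrite rt /= he.
rewrite cat_rcons in rt; have [tg0 _] := xpath_adj (eq_ind _ (fun r => is_true (xpath r)) xr _ rt).
rewrite (bigD1 g0) /=; last by rewrite tg0 he eqxx; apply/suffixP; exists t.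
rewrite big1 ?addr0 // => g /andP[/andP[_ /suffixP[t' rt']] ne].
have sz : size t = size t' by move: (congr1 size rt'); rewrite rt !size_cat /=; lia.
by move: rt'; rewrite rt => /eqP; rewrite eqseq_cat // eqseq_cons [g0 == g]eq_sym (negbTE ne) andbF.
Qed.

Lemma prefix_weight_ge0 s : {in into None, forall r, 0 <= b r} -> 0 <= prefix_weight s.
Proof. by move=> b0; rewrite /prefix_weight big_seq_cond sumr_ge0 // => r /andP[/b0]. Qed.

Lemma arc_weight_conserved v :
  \sum_(e in [pred e | hd e == Some v]) arc_weight e =
  \sum_(e in [pred e | tl e == Some v]) arc_weight e.
Proof.
transitivity (\sum_(g | tl g == Some v) \sum_(e | hd e == Some v)
    \sum_(s <- xp e) prefix_weight (g :: s)); last first.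
  by apply: eq_bigr => g /eqP tg; rewrite -(big_xp _ tg) sum_prefix_weight.
rewrite exchange_big /=; apply: eq_bigr => e /eqP he.
rewrite exchange_big /= -sum_prefix_weight !big_seq; apply: eq_bigr => s.
rewrite mem_xp => /andP[xs]; case: s xs => // e' s xs /eqP[e'e]; rewrite e'e in xs *.
by rewrite prefix_weight_splits.
Qed.

Lemma prefix_weight_route r : r \in into None -> prefix_weight r = b r.
Proof.
move=> rI; have := rI; rewrite mem_into => /andP[xr hr].
rewrite /prefix_weight big_mkcond (bigD1_seq r) ?uniq_into //= suffix_refl.
rewrite big_seq_cond big1 ?addr0 // => q /andP[qI qr]; case: ifP => // /suffixP[t qt].
move: qI; rewrite mem_into => /andP[xq hq].
case/lastP: t qt => [|t g] qt; first by rewrite qt eqxx in qr.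
case: r hr {rI xr qr} qt => // e s /eqP he; rewrite cat_rcons => qt.
by rewrite qt in xq; have [->] := xpath_adj xq; rewrite he.
Qed.

End RouteWeights.

(** A function that splits is determined by its values on complete routes: each path is replaced by
    its continuations until all of them reach a sink. *)
Lemma splits_prefix_weight (R : realFieldType) (a : seq E -> R) s :
  splits a -> xpath s -> prefix_weight a s = a s.
Proof.
move=> aS; case: s => // e s xs.
(* Downward induction on the rank of the last arc, which grows with each continuation. *)
have [n] := ubnP (\max_e rk e - rk e); elim: n e s xs => // n IH e s xs le.
case he: (hd e) => [v|]; last by apply: prefix_weight_route; rewrite mem_into xs he eqxx.
rewrite -(prefix_weight_splits _ xs he) -(aS _ _ _ xs he); apply: eq_bigr => g /eqP tg.
apply: IH; first by rewrite (xpath_consS _ _ tg) he eqxx.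
have := rkP he tg; have : (rk g <= \max_e rk e)%N by apply: leq_bigmax.
by move: le; lia.
Qed.

Definition route_crossing r q := exists v e1 s1 e2 s2 g1 g2,
  [/\ hd e1 = Some v, hd e2 = Some v,
      suffix [:: g2, e1 & s1] r, suffix [:: g1, e2 & s2] q &
      rin_lt (e1 :: s1) (e2 :: s2) && olt v g1 g2].

Lemma uncrossed_prefix_weight (R : realFieldType) (b : seq E -> R) :
  {in into None, forall r, 0 <= b r} ->
  {in into None &, forall r q, 0 < b r -> 0 < b q -> ~ route_crossing r q} ->
  uncrossed (prefix_weight b).
Proof.
move=> b0 nc v e1 s1 e2 s2 g1 g2 _ _ h1 h2 _ _ lt12 ol12.
have ex s : 0 < prefix_weight b s -> exists r, [/\ r \in into None, 0 < b r & suffix s r].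
  move=> pos; have [/hasP[r rI /andP[sr br]]|/hasPn none] :=
    boolP (has (fun r => suffix s r && (0 < b r)) (into None)); first by exists r.
  move: pos; rewrite /prefix_weight big_seq_cond big1 ?ltxx // => r /andP[rI sr].
  have := none r rI; rewrite sr /= -leNgt => le.
  by apply/eqP; rewrite eq_le le b0.
move=> /ex[r [rI br sr]] /ex[q [qI bq sq]]; apply: (nc r q) => //.
by exists v, e1, s1, e2, s2, g1, g2; rewrite lt12 ol12.
Qed.

(** The prefix sums of an uncrossed [b] form a weighting of the flow [arc_weight b], and on complete
    routes they are [b] itself. Hence [b] can be recovered from its arc sums. *)
Lemma route_weight_uniq (R : realFieldType) (b : seq E -> R) :
  {in into None, forall r, 0 <= b r} ->
  {in into None &, forall r q, 0 < b r -> 0 < b q -> ~ route_crossing r q} ->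
  {in into None, forall r, b r = pathweight (arc_weight b) r}.
Proof.
move=> b0 nc r rI; rewrite -(prefix_weight_route b rI).
have a0 e : 0 <= arc_weight b e.
  by rewrite /arc_weight big_seq_cond sumr_ge0 // => q /andP[/b0].
apply: (weighting_uniq a0); first exact: arc_weight_conserved.
  split; [by move=> s _; apply: prefix_weight_ge0|exact: prefix_weight_splits|
    exact: sum_prefix_weight|exact: uncrossed_prefix_weight].
by move: rI; rewrite mem_into => /andP[].
Qed.

Section FlowDecomposition.
Variables (R : realFieldType) (f : E -> R).
Hypothesis f0 : forall e, 0 <= f e.
Hypothesis conserved : forall v,
  \sum_(e in [pred e | hd e == Some v]) f e = \sum_(e in [pred e | tl e == Some v]) f e.

Lemma arc_weight_pathweight g : arc_weight (pathweight f) g = f g.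
Proof.
have [_ wS wF _] := pathweight_weighting f0 conserved.
rewrite -sum_prefix_weight -[RHS]wF !big_seq; apply: eq_bigr => s.
by rewrite mem_xp => /andP[xs _]; apply: splits_prefix_weight.
Qed.

(** A crossing of two routes of positive weight is a crossing of initial parts of them, and these
    also have positive weight because [pathweight] splits. *)
Lemma pathweight_clique : {in into None &, forall r q,
  0 < pathweight f r -> 0 < pathweight f q -> ~ route_crossing r q}.
Proof.
have [w0 wS wF wC] := pathweight_weighting f0 conserved.
have suf s r : r \in into None -> s != [::] -> suffix s r -> 0 < pathweight f r -> 0 < pathweight f s.
  move=> rI s0 sr wr; have xr : xpath r by move: rI; rewrite mem_into => /andP[].
  have xs : xpath s by move: sr xr => /suffixP[t ->]; apply: xpath_cat.
  rewrite -(splits_prefix_weight wS xs) /prefix_weight big_mkcond (bigD1_seq r) ?uniq_into //= sr.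
  by apply: ltr_pwDl => //; apply: sumr_ge0 => q _; case: ifP => // _; apply: pathweight_ge0.
move=> r q rI qI wr wq [v [e1 [s1 [e2 [s2 [g1 [g2 [h1 h2 sr sq /andP[lt12 olt12]]]]]]]]].
have adj e g s r' : r' \in into None -> suffix [:: g, e & s] r' -> tl g = hd e /\ xpath (e :: s).
  rewrite mem_into => /andP[xr _] /suffixP[t rt]; rewrite rt in xr.
  have [-> _] := xpath_adj xr; split=> //; apply: (@xpath_cat (rcons t g)) => //.
  by rewrite cat_rcons.
have [t2 x1] := adj _ _ _ _ rI sr; have [t1 x2] := adj _ _ _ _ qI sq.
rewrite h1 in t2; rewrite h2 in t1.
have w1 := suf [:: g2, e1 & s1] r rI isT sr wr.
have w2 := suf [:: g1, e2 & s2] q qI isT sq wq.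
exact: (wC _ _ _ _ _ _ _ x1 x2 h1 h2 t1 t2 lt12 olt12 w1 w2).
Qed.

End FlowDecomposition.

Section Integrality.
Variables (R : archiRealFieldType) (f : E -> R).
Hypothesis f_int : forall e, f e \is a Num.int.

Lemma pathweight_int s : pathweight f s \is a Num.int.
Proof.
have max_int (x y : R) : x \is a Num.int -> y \is a Num.int -> Num.max x y \is a Num.int.
  by move=> xi yi; rewrite /Num.max; case: ifP.
have min_int (x y : R) : x \is a Num.int -> y \is a Num.int -> Num.min x y \is a Num.int.
  by move=> xi yi; rewrite /Num.min; case: ifP.
have ivl_int : (ivl f s).1 \is a Num.int /\ (ivl f s).2 \is a Num.int.
  elim: s => [|g [|e s] [l_int h_int]] /=; first by rewrite rpred0.
    by case: (tl g) => [?|] /=; rewrite rpred0 f_int.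
  case: (tl g) => [v|] /=; last by rewrite rpred0 f_int.
  have ii : inpos f v e \is a Num.int by apply: rpred_sum.
  have oi : outpos f v g \is a Num.int by apply: rpred_sum.
  by split; [apply: max_int|apply: min_int]; rewrite ?rpred0 // rpredB // rpredD.
by case: ivl_int => ? ?; rewrite /pathweight; apply: max_int; rewrite ?rpred0 // rpredB.
Qed.

End Integrality.

End FramedPaths.

(** * Routes of the augmented graph *)

Section AugmentedRoutes.
Variables (G : digraph) (alpha : vertex G -> int) (A : augmentation alpha).
Variable F : framing A.
Hypothesis dagG : is_dag G.

Local Notation hG := (aug_graph A).
Local Notation harc := (Defs.arc hG).
Local Notation route := (gpath hG).

(** An arc whose tail is outside [V] comes from [VX], and one whose head is outside [V] goes to
    [VY]; thus [None] marks the two ends of the paths considered above. *)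
Definition vertexV (v : vertex hG) : option (vertex G) :=
  if v is inl (inl i) then Some i else None.
Definition headV (e : harc) := vertexV (Defs.head e).
Definition tailV (e : harc) := vertexV (Defs.tail e).

Lemma vertexVP (v : vertex hG) i : (vertexV v == Some i) = (v == inV A i).
Proof. by case: v => [[j|x]|y]. Qed.

Lemma strict_total_order_on_eq (T : finType) (D D' : {pred T}) lt : D =i D' ->
  strict_total_order_on D lt -> strict_total_order_on D' lt.
Proof.
move=> DD [irr tr tot]; split.
- by move=> x; rewrite -DD; apply: irr.
- by move=> x y z; rewrite -!DD; apply: tr.
- by move=> x y; rewrite -!DD; apply: tot.
Qed.

Lemma in_ltV v : strict_total_order_on [pred e | headV e == Some v] (in_lt F v).
Proof. by apply: strict_total_order_on_eq (in_ltP F v) => e; rewrite !inE vertexVP. Qed.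

Lemma out_ltV v : strict_total_order_on [pred e | tailV e == Some v] (out_lt F v).
Proof. by apply: strict_total_order_on_eq (out_ltP F v) => e; rewrite !inE vertexVP. Qed.

Definition adjacent (u v : vertex G) := [exists e : Defs.arc G, (Defs.tail e == u) && (Defs.head e == v)].

Lemma connect_dipath u v : connect adjacent u v -> exists s : seq (Defs.arc G), dipath u s v.
Proof.
move/connectP => [p pp ->]; elim: p u pp => [|w p IH] u /=; first by exists [::] => /=.
case/andP => /existsP[e /andP[/eqP te /eqP he]] /IH[s ds].
by exists (e :: s); rewrite /= te eqxx he.
Qed.

(** The number of ancestors grows strictly along an arc, since in a DAG the head is not an ancestor
    of the tail. *)
Definition vrank (v : vertex G) := #|[set u | connect adjacent u v]|.

Lemma vrank_arc (e : Defs.arc G) : (vrank (Defs.tail e) < vrank (Defs.head e))%N.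
Proof.
have te : connect adjacent (Defs.tail e) (Defs.head e).
  by apply: connect1; apply/existsP; exists e; rewrite !eqxx.
apply/proper_card/properP; split.
  by apply/subsetP => u; rewrite !inE => /connect_trans; apply.
exists (Defs.head e); rewrite !inE ?connect0 //.
apply/negP => /connect_dipath[s ds].
by have := dagG (Defs.tail e) (s := e :: s) isT; rewrite /= eqxx ds.
Qed.

Definition arank (e : harc) : nat := if tailV e is Some v then (vrank v).+1 else 0.

Lemma arank_lt e g v : headV e = Some v -> tailV g = Some v -> (arank e < arank g)%N.
Proof.
rewrite {2}/arank => he ->; case: e he => [[e|e]|e] //= [<-]; rewrite /arank /=.
by rewrite ltnS vrank_arc.
Qed.

Definition xroute := into headV tailV arank None.

(** As [None] stands for added sources and added sinks alike, equality of options expresses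
    adjacency only away from [None]. *)
Lemma adjE (e g : harc) :
  (Defs.tail g == Defs.head e) = (tailV g != None) && (headV e == tailV g).
Proof.
rewrite /headV /tailV /= /aug_head /aug_tail.
by case: e => [[e|e]|e]; case: g => [[g|g]|g].
Qed.

Lemma rev_lastI (T : Type) (e : T) s : rev (e :: s) = last e s :: rev (belast e s).
Proof. by rewrite lastI rev_rcons. Qed.

Lemma last_rev_belast (T : Type) (e : T) s : last (last e s) (rev (belast e s)) = e.
Proof.
by rewrite -[LHS]/(last e (last e s :: rev (belast e s))) -rev_lastI rev_cons last_rcons.
Qed.

Lemma xpath_revE e s : xpath headV tailV (rev (e :: s)) =
  (tailV e == None) && path (fun e g : harc => Defs.tail g == Defs.head e) e s.
Proof.
elim/last_ind: s => [|s g IH]; first by rewrite andbT.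
rewrite rcons_path -rcons_cons rev_rcons andbA -IH andbC.
by rewrite rev_lastI xpath_cons andbA adjE.
Qed.

Lemma dipathE u e s v : dipath (G := hG) u (e :: s) v =
  [&& Defs.tail e == u, path (fun e g : harc => Defs.tail g == Defs.head e) e s
    & Defs.head (last e s) == v].
Proof.
rewrite /=; congr (_ && _); elim: s e => [|g s IH] e //=.
by rewrite IH andbA.
Qed.

Variable v0 : vertex hG.

(* The value at the empty sequence is irrelevant. *)
Definition route_of (r : seq harc) : route :=
  (if r is e :: s then Defs.tail (last e s) else v0, rev r).

Definition xroutes : seq route := [seq route_of r | r <- xroute].

Lemma path_end_cons u e (s : seq harc) :
  path_end (G := hG) (u, e :: s) = Defs.head (last e s).
Proof. by rewrite /path_end /= last_map. Qed.

Lemma uniq_xroutes : uniq xroutes.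
Proof.
rewrite map_inj_in_uniq; first exact: uniq_into arank_lt _.
by move=> r q _ _ [_ /(can_inj (@revK _))].
Qed.

Lemma revK_xroutes p : p \in xroutes -> rev p.2 \in xroute /\ route_of (rev p.2) = p.
Proof. by move=> /mapP[r rx ->] /=; rewrite revK. Qed.

Lemma mem_xroutes (p : route) : (p \in xroutes) =
  [&& (if p.1 is inl (inr _) then true else false),
      (if path_end p is inr _ then true else false) & dipath p.1 p.2 (path_end p)].
Proof.
case: p => u s; apply/idP/idP.
  move=> /revK_xroutes /= []; rewrite /xroute mem_into; last exact: arank_lt.
  case: s => // e s; rewrite xpath_revE rev_lastI => /andP[/andP[te ps] /eqP he].
  rewrite /route_of /= last_rev_belast => -[ue _].
  rewrite path_end_cons -[X in [&& _, _ & X]]/(dipath (G := hG) u (e :: s) _) dipathE.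
  rewrite ps -ue !eqxx !andbT; move: te he; rewrite /tailV /headV; case: (last e s) => [[?|?]|?] //.
  by case: e {ps ue} => [[?|?]|?].
case/and3P => /= ux ey ds; case: s ey ds => [|e s].
  by rewrite /path_end /=; case: u ux => [[]|].
rewrite path_end_cons dipathE => ey /and3P[/eqP te ps _].
have -> : (u, e :: s) = route_of (rev (e :: s)).
  by rewrite /route_of revK rev_lastI last_rev_belast te.
apply: map_f; rewrite /xroute mem_into; last exact: arank_lt.
rewrite xpath_revE ps andbT rev_lastI; apply/andP; split.
  by move: te ux; rewrite /tailV; case: u => [[]|] // a ->.
by move: ey; rewrite /headV; case: (Defs.head _) => [[]|].
Qed.

Lemma xroutesP p : p \in xroutes -> exists x y e s,
  [/\ p = (inX x, e :: s), Defs.tail e = inX x, Defs.head (last e s) = inY y &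
      path (fun e g : harc => Defs.tail g == Defs.head e) e s].
Proof.
rewrite mem_xroutes; case: p => u s; case/and3P => /=.
case: u => [[//|x]|//] _; case: s => [|e s]; first by rewrite /path_end.
rewrite path_end_cons dipathE; case ey: (Defs.head _) => [//|y] _ /and3P[/eqP te ps _].
by exists x, y, e, s; split.
Qed.

Lemma is_route_xroutes p : p \in xroutes -> is_route p.
Proof.
move=> px; have [x [y [e [s [pE te he ps]]]]] := xroutesP px.
rewrite pE /is_route path_end_cons; apply/and3P; split.
- by apply/forallP => -[[g|g]|g].
- by rewrite he; apply/forallP => -[[g|g]|g].
by rewrite -[dipath _ _ _]/(dipath (G := hG) (inX x) (e :: s) _) dipathE te ps !eqxx.
Qed.

Lemma tailX_inj : injective (@tailX _ _ A).
Proof.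
move=> e g eg; have /eqP/cards1P[z zE] := card_tailX (tailX g).
have : e \in [set e | tailX e == tailX g] by rewrite inE eg.
have : g \in [set e | tailX e == tailX g] by rewrite inE.
by rewrite zE !inE => /eqP-> /eqP->.
Qed.

Lemma headY_inj : injective (@headY _ _ A).
Proof.
move=> e g eg; have /eqP/cards1P[z zE] := card_headY (headY g).
have : e \in [set e | headY e == headY g] by rewrite inE eg.
have : g \in [set e | headY e == headY g] by rewrite inE.
by rewrite zE !inE => /eqP-> /eqP->.
Qed.

Lemma path_mem (e g : harc) s : path (fun e g : harc => Defs.tail g == Defs.head e) e s ->
  g \in s -> tailV g != None.
Proof.
elim: s e => //= h s IH e /andP[he ps]; rewrite inE => /predU1P[->|]; last exact: IH ps.
by move: he; rewrite -/(Defs.tail (d := hG) h) -/(Defs.head (d := hG) e) adjE => /andP[].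
Qed.

Lemma path_mem_belast (e g : harc) s : path (fun e g : harc => Defs.tail g == Defs.head e) e s ->
  g \in belast e s -> headV g != None.
Proof.
elim: s e => //= h s IH e /andP[he ps]; rewrite inE => /predU1P[->|]; last exact: IH ps.
move: he; rewrite -/(Defs.tail (d := hG) h) -/(Defs.head (d := hG) e) adjE => /andP[t].
by move=> /eqP ->.
Qed.

(** A route can use an inflow edge only as its first arc, and each vertex of [VX] carries a single
    one. Hence the flow on an inflow edge counts the routes starting at its tail. *)
Lemma mem_sourceE p e : p \in xroutes ->
  (inl (inr e) \in p.2) = (p.1 == inX (tailX e)).
Proof.
move=> /xroutesP[x [y [g [s [-> te _ ps]]]]] /=; rewrite inE.
have -> : (inl (inr e) \in s) = false by apply/negP => /(path_mem ps).
rewrite orbF; case: g te {ps} => [[g|g]|g] //= [<-].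
by apply/eqP/eqP => [[->]//|[/tailX_inj ->]].
Qed.

Lemma mem_sinkE p e : p \in xroutes ->
  (inr e \in p.2) = (path_end p == inY (headY e)).
Proof.
move=> /xroutesP[x [y [g [s [-> _ he ps]]]]]; rewrite path_end_cons [_.2]/= lastI mem_rcons inE.
have -> : (inr e \in belast g s) = false by apply/negP => /(path_mem_belast ps).
rewrite orbF; case: (last g s) he => [[h|h]|h] //= _.
by apply/eqP/eqP => [[->]//|[/headY_inj ->]].
Qed.

Definition crossing (p q : route) := route_crossing headV (in_lt F) (out_lt F)
  (rev p.2) (rev q.2).

Fixpoint rout_lt (s1 s2 : seq harc) : bool :=
  if (s1, s2) is (e1 :: t1, e2 :: t2) then
    if e1 == e2 then rout_lt t1 t2
    else if tailV e1 is Some v then out_lt F v e1 e2 else false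
  else false.

Lemma rout_ltP s1 s2 : path_out_lt F s1 s2 <-> rout_lt s1 s2.
Proof.
split=> [[v [s [p' [q' [f [g [-> -> ne tf lt]]]]]]]|].
  elim: s => [|e s IH] /=; last by rewrite eqxx.
  by rewrite (negbTE ne) /tailV tf /=.
elim: s1 s2 => [|e1 t1 IH] [|e2 t2] //=; have [<-|ne] := eqVneq e1 e2.
  move=> /IH [v [s [p' [q' [f [g [-> -> ne tf lt]]]]]]].
  by exists v, (e1 :: s), p', q', f, g.
case te: (tailV e1) => [v|//] lt; exists v, [::], t1, t2, e1, e2; split=> //.
by apply/eqP; rewrite -vertexVP -/(tailV e1) te.
Qed.

Lemma rin_ltP s1 s2 : path_in_lt F (rev s1) (rev s2) <-> rin_lt headV (in_lt F) s1 s2.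
Proof.
split=> [[v [s [p' [q' [f [g [/(congr1 rev) + /(congr1 rev) + ne hf lt]]]]]]]|].
  rewrite !revK !rev_cat !rev_cons !cat_rcons => -> ->.
  elim: (rev s) => [|e s' IH] /=; last by rewrite eqxx.
  by rewrite (negbTE ne) /headV hf /=.
elim: s1 s2 => [|e1 t1 IH] [|e2 t2] //=; have [<-|ne] := eqVneq e1 e2.
  move=> /IH [v [s [p' [q' [f [g [pE qE ne hf lt]]]]]]].
  exists v, (rcons s e1), p', q', f, g; split=> //.
    by rewrite rev_cons pE rcons_cat.
  by rewrite rev_cons qE rcons_cat.
case he: (headV e1) => [v|//] lt; exists v, [::], (rev t1), (rev t2), e1, e2; split=> //.
- by rewrite rev_cons cats1.
- by rewrite rev_cons cats1.
by apply/eqP; rewrite -vertexVP -/(headV e1) he.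
Qed.

Lemma rin_lt_cat s s1 s2 :
  rin_lt headV (in_lt F) (s ++ s1) (s ++ s2) = rin_lt headV (in_lt F) s1 s2.
Proof. by elim: s => //= e s ->; rewrite eqxx. Qed.

(** In [crossing_at] the vertex [i] may lie anywhere on the stretch common to both routes. Moving it
    forward to the vertex where they separate lengthens the common final part of the incoming paths
    without changing their order. *)
Lemma crossingP p q : p \in xroutes -> q \in xroutes ->
  (exists i, crossing_at F i p q) <-> crossing p q.
Proof.
move=> px qx; have adjx z s e g t : z \in xroutes -> rev z.2 = s ++ [:: g, e & t] ->
    tailV g = headV e /\ tailV g != None.
  move=> /revK_xroutes[+ _] zE; rewrite /xroute mem_into; last exact: arank_lt.
  by rewrite zE => /andP[/xpath_adj].
have pathE (u : vertex hG) ee t : path_end (u, rev (ee :: t)) = Defs.head ee.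
  by rewrite /path_end /= map_rev rev_cons last_rcons.
split.
  move=> [i [p1 [p2 [q1 [q2 [[pE pi] [qE qi] lt1 lt2]]]]]].
  have [v [s [q' [p' [g1 [g2 [q2E p2E ne tg lto]]]]]]] := lt2.
  have [v' [s' [pp [qq [f1 [f2 [p1E q1E _ _ _]]]]]]] := lt1.
  rewrite -[p1]revK -[q1]revK in lt1; move/rin_ltP: lt1 => lt1.
  have rp : rev p.2 = rev p' ++ g2 :: rev s ++ rev p1.
    by rewrite pE p2E !rev_cat rev_cons -!catA cat_rcons.
  have rq : rev q.2 = rev q' ++ g1 :: rev s ++ rev q1.
    by rewrite qE q2E !rev_cat rev_cons -!catA cat_rcons.
  have [e1 [t1 E1]] : exists e1 t1, rev s ++ rev p1 = e1 :: t1.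
    case E1: (rev s ++ rev p1) => [|e1 t1]; last by exists e1, t1.
    by exfalso; move: (congr1 size E1); rewrite size_cat !size_rev p1E size_cat /=; lia.
  have [e2 [t2 E2]] : exists e2 t2, rev s ++ rev q1 = e2 :: t2.
    case E2: (rev s ++ rev q1) => [|e2 t2]; last by exists e2, t2.
    by exfalso; move: (congr1 size E2); rewrite size_cat !size_rev q1E size_cat /=; lia.
  (* Either the routes share the last arc of the stretch after [i], or this stretch is empty and
     both arcs enter [i]. *)
  have h12 : headV e1 = headV e2.
    move: E1 E2; case/lastP: s {p2E q2E rp rq} => [|s z]; last by rewrite !rev_rcons => -[-> _] [->].
    move=> /(congr1 rev) + /(congr1 rev); rewrite !revK => p1E' q1E'.
    by move: pi qi; rewrite p1E' q1E' !pathE /headV => /= -> ->.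
  rewrite E1 in rp; rewrite E2 in rq.
  have [tg1 _] := adjx _ _ _ _ _ qx rq; have tgv : tailV g1 = Some v by rewrite /tailV tg.
  exists v, e1, t1, e2, t2, g1, g2; split.
  - by rewrite h12 -tg1.
  - by rewrite -tg1.
  - by apply/suffixP; exists (rev p').
  - by apply/suffixP; exists (rev q').
  by rewrite -E1 -E2 rin_lt_cat lt1.
move=> [v [e1 [t1 [e2 [t2 [g1 [g2 [h1 h2 /suffixP[p' rp] /suffixP[q' rq] /andP[lt1 lt2]]]]]]]]].
have [tg1 _] := adjx _ _ _ _ _ qx rq.
have hV ee : headV ee = Some v -> Defs.head ee = inV A v by move=> hee; apply/eqP; rewrite -vertexVP -/(headV ee) hee.
have E z z' g ee t : rev z = z' ++ [:: g, ee & t] -> z = rev (ee :: t) ++ g :: rev z'.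
  by move=> /(congr1 rev); rewrite revK => ->; rewrite rev_cat rev_cons cat_rcons.
exists (inV A v), (rev (e1 :: t1)), (g2 :: rev p'), (rev (e2 :: t2)), (g1 :: rev q').
split.
- by rewrite pathE hV //; split=> //; apply: E.
- by rewrite pathE hV //; split=> //; apply: E.
- exact/rin_ltP.
apply/rout_ltP => /=; have ne : g1 != g2.
  apply/eqP => g12; have [irr _ _] := out_ltV v.
  by move: lt2; rewrite g12 irr // inE -g12 tg1 h2.
by rewrite (negbTE ne) tg1 h2.
Qed.

Section Weights.
Variable R : archiRealFieldType.
Implicit Types a : route -> R.

Definition flow_of a (g : harc) := \sum_(p <- xroutes | g \in p.2) a p.

Definition uncrossing a :=
  {in xroutes &, forall p q, 0 < a p -> 0 < a q -> ~ crossing p q}.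

Lemma flow_ofE a g : flow_of a g = arc_weight headV tailV arank (a \o route_of) g.
Proof. by rewrite /flow_of big_map; apply: eq_bigl => r; rewrite mem_rev. Qed.

Lemma flow_of_conserved a v :
  \sum_(e in [pred e | headV e == Some v]) flow_of a e =
  \sum_(e in [pred e | tailV e == Some v]) flow_of a e.
Proof.
under eq_bigr do rewrite flow_ofE; under [RHS]eq_bigr do rewrite flow_ofE.
exact: (arc_weight_conserved arank_lt (a \o route_of) v).
Qed.

Lemma uncrossing_weightE a p : {in xroutes, forall p, 0 <= a p} -> uncrossing a ->
  p \in xroutes ->
  a p = pathweight headV tailV (in_lt F) (out_lt F) (flow_of a) (rev p.2).
Proof.
move=> a0 nc px; have [rx pE] := revK_xroutes px.
have -> : a p = (a \o route_of) (rev p.2) by rewrite /= pE.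
rewrite (@route_weight_uniq _ _ _ _ _ _ _ in_ltV out_ltV arank_lt _ (a \o route_of)) //.
- by congr (pathweight _ _ _ _ _ _); apply/funext => g; rewrite flow_ofE.
- by move=> r rI; apply: a0; apply: map_f.
move=> r q rI qI ar aq; have := nc _ _ (map_f route_of rI) (map_f route_of qI) ar aq.
by rewrite /crossing /= !revK.
Qed.

Lemma uncrossing_weight_uniq a b :
  {in xroutes, forall p, 0 <= a p} -> {in xroutes, forall p, 0 <= b p} ->
  uncrossing a -> uncrossing b -> flow_of a =1 flow_of b -> {in xroutes, a =1 b}.
Proof.
move=> a0 b0 na nb ab p px; rewrite !uncrossing_weightE //.
by congr (pathweight _ _ _ _ _ _); apply/funext.
Qed.

Lemma uncrossing_weight_int a : {in xroutes, forall p, 0 <= a p} -> uncrossing a ->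
  (forall g, flow_of a g \is a Num.int) -> {in xroutes, forall p, a p \is a Num.int}.
Proof. by move=> a0 na fi p px; rewrite uncrossing_weightE //; apply: pathweight_int. Qed.

Lemma uncrossing_decomposition (f : harc -> R) : (forall g, 0 <= f g) ->
  (forall v, \sum_(e in [pred e | headV e == Some v]) f e =
             \sum_(e in [pred e | tailV e == Some v]) f e) ->
  exists a, [/\ forall p, 0 <= a p, uncrossing a & flow_of a =1 f].
Proof.
move=> f0 fc.
exists (fun p => pathweight headV tailV (in_lt F) (out_lt F) f (rev p.2)); split.
- by move=> p; apply: pathweight_ge0.
- move=> p q /revK_xroutes[pI _] /revK_xroutes[qI _].
  exact: (pathweight_clique in_ltV out_ltV arank_lt f0 fc pI qI).
move=> g; rewrite flow_ofE -[RHS](arc_weight_pathweight in_ltV out_ltV arank_lt f0 fc).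
by apply: eq_bigr => r _ /=; rewrite revK.
Qed.

End Weights.

End AugmentedRoutes.

(** * Layerings *)

Section Layerings.
Variables (G : digraph) (alpha : vertex G -> int) (A : augmentation alpha).
Variable F : framing A.
Hypothesis dagG : is_dag G.

Local Notation hG := (aug_graph A).
Local Notation harc := (Defs.arc hG).
Local Notation route := (gpath hG).
Local Notation layering := {fset route}.

Variable v0 : vertex hG.
Local Notation xroutes := (xroutes v0).

Lemma VX_tail x : exists e, @tailX _ _ A e = x.
Proof.
have /eqP/cards1P[e eE] := card_tailX x.
have : e \in [set e] by rewrite inE.
by rewrite -eE inE => /eqP; exists e.
Qed.

Lemma VY_head y : exists e, @headY _ _ A e = y.
Proof.
have /eqP/cards1P[e eE] := card_headY y.
have : e \in [set e] by rewrite inE.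
by rewrite -eE inE => /eqP; exists e.
Qed.

Lemma inX_source x : is_source (G := hG) (inX x).
Proof. by apply/forallP => -[[g|g]|g]. Qed.

Lemma inY_sink y : is_sink (G := hG) (inY y).
Proof. by apply/forallP => -[[g|g]|g]. Qed.

(** A vertex of [V] may be a source or a sink of the augmented graph too, but its netflow there is
    0, so no route of a layering starts or ends at it. *)
Lemma layering_xroutes (L : layering) : is_layering L -> {subset L <= xroutes}.
Proof.
move=> [Lr Ls Lt] p pL; have := Lr p pL; case: p pL => u s pL /and3P[us es ds].
have ns := Ls _ us; have nt := Lt _ es.
have pos (P : pred route) n : P (u, s) -> #|` [fset q in L | P q]%fset |%:Z = n -> n != 0.
  move=> Pp <-; rewrite eqz_nat -lt0n cardfs_gt0.
  by apply/fset0Pn; exists (u, s); rewrite !inE /= pL Pp.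
have {}ns := pos _ _ (eqxx u) ns.
have {}nt := pos (fun q => path_end q == path_end (u, s)) _ (eqxx _) nt.
rewrite mem_xroutes //= ds andbT; apply/andP; split.
  case: u us ns {pL pos es ds nt} => [[i|x]|y] //= us _.
  by have [e ey] := VY_head y; have := forallP us (inr e); rewrite /= ey eqxx.
case: (path_end (u, s)) es nt => [[i|x]|y] //= es _.
by have [e ex] := VX_tail x; have := forallP es (inl (inr e)); rewrite /= ex eqxx.
Qed.

Lemma layering_start1 (L : layering) x : is_layering L ->
  exists p, [fset q in L | q.1 == inX x]%fset = [fset p]%fset.
Proof.
move=> [_ Ls _].
have /eqP : #|` [fset q in L | q.1 == inX x]%fset |%:Z = 1%:Z := Ls _ (inX_source x).
by rewrite eqz_nat => /cardfs1P[p pE]; exists p.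
Qed.

Lemma layering_start (L : layering) x : is_layering L ->
  exists2 p, p \in L & p.1 = inX x.
Proof.
move=> Ll; have [p pE] := layering_start1 x Ll; have : p \in [fset p]%fset by rewrite inE.
by rewrite -pE !inE => /andP[pL /eqP]; exists p.
Qed.

Lemma layering_start_uniq (L : layering) p q : is_layering L ->
  p \in L -> q \in L -> p.1 = q.1 -> p = q.
Proof.
move=> Ll pL qL pq; have [x [y [e [s [pE _ _ _]]]]] := xroutesP dagG (layering_xroutes Ll pL).
have [r rE] := layering_start1 x Ll.
have p1 : p.1 = inX x by rewrite pE.
have : p \in [fset r]%fset by rewrite -rE !inE pL p1 /=.
have : q \in [fset r]%fset by rewrite -rE !inE qL -pq p1 /=.
by rewrite !inE => /eqP-> /eqP->.
Qed.

Lemma layering_of (h : VX A -> VY A) (r : VX A -> route) :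
  (forall x, r x \in xroutes) -> (forall x, (r x).1 = inX x) ->
  (forall x, path_end (r x) = inY (h x)) ->
  (forall y, #|[set x | h x == y]|%:Z = `|netflowY y|) ->
  is_layering [fset r x | x in VX A]%fset.
Proof.
move=> rx rs rt hy; have rinj : injective r.
  by move=> x x' /(congr1 fst); rewrite !rs => -[].
split=> [p /imfsetP[x _ ->]|i|j].
- exact: is_route_xroutes.
- case: i => [[i|x]|y] /= si.
  + apply/eqP; rewrite eqz_nat cardfs_eq0; apply/eqP/fsetP => p; rewrite !inE.
    by apply/negP => /andP[/imfsetP[x _ ->]] /=; rewrite rs.
  + apply/eqP; rewrite eqz_nat; apply/cardfs1P; exists (r x).
    apply/fsetP => p; rewrite !inE; apply/andP/eqP => [[/imfsetP[x' _ ->]]|->].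
      by rewrite /= rs => /eqP[->].
    by rewrite rs eqxx; split=> //; apply: in_imfset.
  + by have [e ey] := VY_head y; have := forallP si (inr e); rewrite /= ey eqxx.
case: j => [[i|x]|y] /= sj.
- apply/eqP; rewrite normr0 eqz_nat cardfs_eq0; apply/eqP/fsetP => p; rewrite !inE.
  by apply/negP => /andP[/imfsetP[x _ ->]] /=; rewrite rt.
- by have [e ex] := VX_tail x; have := forallP sj (inl (inr e)); rewrite /= ex eqxx.
rewrite -hy; congr (_%:Z); rewrite cardE -(size_map r) cardfE.
rewrite -cardfE; apply/esym; rewrite -(@undup_id _ (map r _)); last first.
  by rewrite map_inj_uniq ?enum_uniq.
rewrite -card_fseq; congr (#|` _|); apply/fsetP => p; rewrite !inE.
apply/mapP/andP => [[x]|[/imfsetP[x _ ->]]].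
  by rewrite mem_enum inE => /eqP hx ->; rewrite rt hx eqxx; split=> //; apply: in_imfset.
by rewrite rt => /eqP[hx]; exists x; rewrite // mem_enum inE hx.
Qed.

Lemma rout_lt_irr s : rout_lt F s s = false.
Proof. by elim: s => //= e s ->; rewrite eqxx. Qed.

Lemma rout_lt_trans u s1 s2 s3 (w1 w2 w3 : vertex hG) :
  dipath u s1 w1 -> dipath u s2 w2 -> dipath u s3 w3 ->
  rout_lt F s1 s2 -> rout_lt F s2 s3 -> rout_lt F s1 s3.
Proof.
elim: s1 u s2 s3 => [|e1 s1 IH] u [|e2 s2] [|e3 s3] //.
rewrite /dipath -/(dipath _ _ _) => /andP[/eqP t1 d1] /andP[/eqP t2 d2] /andP[/eqP t3 d3] /=.
have [e12|ne12] := eqVneq e1 e2.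
  rewrite -e12; have [e13|//] := eqVneq e1 e3.
  by apply: IH d1 _ _; [rewrite e12|rewrite e13].
have [e23|ne23] := eqVneq e2 e3; first by rewrite -e23 (negbTE ne12).
have tv e : Defs.tail e = u -> tailV e = vertexV u by rewrite /tailV => ->.
rewrite !tv //; case uv: (vertexV u) => [v|//] lt12 lt23.
have [irr tr _] := out_ltV F v.
have iv e : Defs.tail e = u -> e \in [pred e | tailV e == Some v] by move=> te; rewrite inE tv // uv.
have lt13 := tr e2 e1 e3 (iv _ t2) (iv _ t1) (iv _ t3) lt12 lt23.
by have [e13|] := eqVneq e1 e3; first by rewrite e13 irr ?iv in lt13.
Qed.

Lemma rout_lt_total (u : vertex hG) s1 s2 y1 y2 :
  dipath (G := hG) u s1 (inY y1) -> dipath (G := hG) u s2 (inY y2) ->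
  s1 != s2 -> rout_lt F s1 s2 || rout_lt F s2 s1.
Proof.
elim: s1 u s2 => [|e1 s1 IH] u [|e2 s2] //.
- move=> /eqP-> /andP[+ _] _; by case: e2 => [[e|e]|e].
- move=> /andP[+ _] /eqP uy; rewrite uy; by case: e1 => [[e|e]|e].
rewrite /dipath -/(dipath _ _ _) => /andP[/eqP t1 d1] /andP[/eqP t2 d2].
rewrite eqseq_cons /= [e2 == e1]eq_sym; have [e12|ne12] /= := eqVneq e1 e2.
  by apply: IH d1 _; rewrite e12.
have tv e : Defs.tail e = u -> tailV e = vertexV u by rewrite /tailV => ->.
rewrite !tv // => _; case uv: (vertexV u) => [v|].
  have [_ _ tot] := out_ltV F v.
  by apply: tot => //; rewrite inE tv // uv.
(* Outside [V] only the vertices of [VX] have a leaving arc, and just one, so two paths cannot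
   separate there. *)
case: e1 t1 ne12 {d1} => [[e1|e1]|e1] t1 ne12; move: uv t2; rewrite -t1 //= => _.
by case: e2 ne12 {d2} => [[e2|e2]|e2] ne12 //= [/tailX_inj e21]; rewrite e21 eqxx in ne12.
Qed.

Lemma layering_ltP (L M : layering) : layering_lt F L M <-> exists x p q,
  [/\ p \in L /\ p.1 = inX x, q \in M /\ q.1 = inX x, rout_lt F p.2 q.2 &
    forall y r, src_lt F x y -> r.1 = inX y -> (r \in L) = (r \in M)].
Proof. by split=> -[x [p [q [? ? /rout_ltP lt ?]]]]; exists x, p, q. Qed.

Lemma layering_lt_irr L : is_layering L -> ~ layering_lt F L L.
Proof.
move=> Ll /layering_ltP[x [p [q [[pL px] [qL qx] lt _]]]].
by rewrite (layering_start_uniq Ll pL qL) ?rout_lt_irr ?px ?qx in lt.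
Qed.

Lemma layering_lt_trans L M N : is_layering L -> is_layering M -> is_layering N ->
  layering_lt F L M -> layering_lt F M N -> layering_lt F L N.
Proof.
move=> Ll Ml Nl /layering_ltP[x [p [q [[pL px] [qM qx] lt1 eq1]]]].
move=> /layering_ltP[y [p' [q' [[p'M p'y] [q'N q'y] lt2 eq2]]]]; apply/layering_ltP.
have [irr tr tot] := src_ltP F.
have dip (K : layering) r : is_layering K -> r \in K -> dipath (G := hG) r.1 r.2 (path_end r).
  by move=> [Kr _ _] /Kr /and3P[].
have [xy|nxy] := eqVneq x y.
  exists x, p, q'; split=> //; first by rewrite q'y xy.
    have qp' : q = p' by apply: layering_start_uniq Ml qM p'M _; rewrite qx p'y xy.
    have := dip _ _ Ll pL; have := dip _ _ Ml qM; have := dip _ _ Nl q'N.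
    rewrite -qp' in lt2; rewrite px qx q'y -xy => d3 d2 d1.
    exact: rout_lt_trans d1 d2 d3 lt1 lt2.
  by move=> z r xz rz; rewrite (eq1 z) // (eq2 z) // -xy.
have /orP[lxy|lyx] := tot x y isT isT nxy.
  exists y, p', q'; split=> //.
    by split=> //; rewrite (eq1 y).
  move=> z r yz rz; rewrite (eq1 z) // ?(eq2 z) //.
  exact: (tr y).
exists x, p, q; split=> //.
  by split=> //; rewrite -(eq2 x).
move=> z r xz rz; rewrite (eq1 z) // (eq2 z) //.
exact: (tr x).
Qed.

Lemma layering_lt_total L M : is_layering L -> is_layering M -> L != M ->
  layering_lt F L M \/ layering_lt F M L.
Proof.
move=> Ll Ml ne.
(* The type of routes is not finite, so the boolean quantifier ranges over positions in
   [xroutes]. *)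
pose D := [set x | [exists r : 'I_(size xroutes), let p := nth (v0, [::]) xroutes r in
   (p.1 == inX x) && ((p \in L) != (p \in M))]].
have DP x : reflect (exists p, [/\ p \in xroutes, p.1 = inX x & (p \in L) != (p \in M)]) (x \in D).
  rewrite inE; apply: (iffP existsP) => [[r /andP[/eqP px pn]]|[p [px ps pn]]].
    by exists (nth (v0, [::]) xroutes r); split=> //; apply: mem_nth.
  have ip : (index p xroutes < size xroutes)%N by rewrite index_mem.
  by exists (Ordinal ip); rewrite /= nth_index // ps eqxx.
have D0 : D != set0.
  apply: contra_neq ne => D0; apply/fsetP => p; apply/eqP/negPn/negP => pn.
  have px : p \in xroutes.
    case: (boolP (p \in L)) pn => [pL _|_]; first exact: layering_xroutes Ll _ pL.
    by case: (boolP (p \in M)) => // pM _; apply: layering_xroutes Ml _ pM.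
  have [x [y [e [s [pE _ _ _]]]]] := xroutesP dagG px.
  suff : x \in D by rewrite D0 inE.
  by apply/DP; exists p; split=> //; rewrite pE.
have [|x xD xmax] := strict_max (src_ltP F) _ D0; first exact/subsetP.
have above y r : src_lt F x y -> r.1 = inX y -> (r \in L) = (r \in M).
  move=> xy ry; apply/eqP/negPn/negP => rn.
  have rx : r \in xroutes.
    case: (boolP (r \in L)) rn => [rL _|_]; first exact: layering_xroutes Ll _ rL.
    by case: (boolP (r \in M)) => // rM _; apply: layering_xroutes Ml _ rM.
  have yD : y \in D by apply/DP; exists r.
  have [irr tr _] := src_ltP F.
  have [yx|nyx] := eqVneq y x; first by rewrite yx irr in xy.
  have := xmax y yD nyx => yx.
  by have := tr y x x isT isT isT xy yx; rewrite irr.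
have [p pL px] := layering_start x Ll; have [q qM qx] := layering_start x Ml.
have pq : p != q.
  apply/eqP => pq; have [r [_ rx rn]] := DP x xD.
  have : (r \in L) = (r \in M).
    apply/idP/idP => rI.
      by rewrite (layering_start_uniq Ll rI pL) ?rx ?px // pq.
    by rewrite (layering_start_uniq Ml rI qM) ?rx ?qx // -pq.
  by move=> rE; rewrite rE eqxx in rn.
have [xp [yp [ep [sp [pE tp hp pp]]]]] := xroutesP dagG (layering_xroutes Ll pL).
have [xq [yq [eq [sq [qE tq hq pq']]]]] := xroutesP dagG (layering_xroutes Ml qM).
have dp : dipath (G := hG) (inX x) p.2 (inY yp).
  by rewrite pE dipathE pp hp !eqxx tp !andbT; rewrite pE in px; apply/eqP.
have dq : dipath (G := hG) (inX x) q.2 (inY yq).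
  by rewrite qE dipathE pq' hq !eqxx tq !andbT; rewrite qE in qx; apply/eqP.
have ne2 : p.2 != q.2.
  by apply: contra_neq pq => e2; case: p q px qx e2 {pL qM pE qE dp dq} => [? ?] [? ?] /= -> -> ->.
have /orP[lt|lt] := rout_lt_total dp dq ne2.
  by left; apply/layering_ltP; exists x, p, q.
right; apply/layering_ltP; exists x, q, p; split=> // y r xy ry.
by rewrite (above y).
Qed.

End Layerings.

(** * Layering-simplices *)

Lemma exists_minimum (T : eqType) (s : seq T) (P : T -> Prop) (lt : T -> T -> Prop) :
  (forall x y z, P x -> P y -> P z -> lt x y -> lt y z -> lt x z) ->
  (forall x y, P x -> P y -> x != y -> lt x y \/ lt y x) ->
  (exists2 x, x \in s & P x) ->
  exists m, [/\ m \in s, P m & forall x, x \in s -> P x -> x = m \/ lt m x].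
Proof.
move=> tr tot; elim: s => [[]//|k s IH] [x0 x0s Px0].
have [[x xs Px]|none] := pselect (exists2 x, x \in s & P x); last first.
  have Pk : P k.
    by move: x0s; rewrite inE => /predU1P[<-//|x0s]; case: none; exists x0.
  exists k; split; rewrite ?mem_head // => x; rewrite inE => /predU1P[->|xs Px]; first by left.
  by case: none; exists x.
have [|m [ms Pm mmin]] := IH; first by exists x.
have [Pk|nPk] := pselect (P k); last first.
  exists m; split; rewrite ?inE ?ms ?orbT // => z; rewrite inE => /predU1P[->//|]; exact: mmin.
have [->|km] := eqVneq k m.
  exists m; split; rewrite ?mem_head // => z; rewrite inE => /predU1P[->|]; [by left|exact: mmin].
have [kltm|mltk] := tot _ _ Pk Pm km.
  exists k; split; rewrite ?mem_head // => z; rewrite inE => /predU1P[->|zs Pz]; first by left.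
  by right; case: (mmin z zs Pz) => [->//|]; apply: tr.
exists m; split; rewrite ?inE ?ms ?orbT // => z; rewrite inE => /predU1P[->|]; [by right|exact: mmin].
Qed.

Section Simplices.
Variables (G : digraph) (alpha : vertex G -> int) (A : augmentation alpha).
Variable F : framing A.
Hypotheses (dagG : is_dag G) (alpha_neq0 : exists i, alpha i != 0).

Local Notation hG := (aug_graph A).
Local Notation harc := (Defs.arc hG).
Local Notation route := (gpath hG).
Local Notation layering := {fset route}.

Variable v0 : vertex hG.
Local Notation xroutes := (xroutes v0).

Lemma min_layering (K : {fset route}) : (exists2 L, is_layering L & (L `<=` K)%fset) ->
  exists L, [/\ is_layering L, (L `<=` K)%fset &
    forall M, is_layering M -> (M `<=` K)%fset -> L = M \/ layering_lt F L M].
Proof.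
move=> [L Ll LK].
have [|||M [MK Ml Mmin]] := @exists_minimum _ (fpowerset K) (@is_layering _ _ A) (layering_lt F) _ _ _.
- exact: layering_lt_trans.
- exact: layering_lt_total.
- by exists L; rewrite ?fpowersetE.
exists M; split=> //; first by rewrite -fpowersetE.
by move=> N Nl NK; case: (Mmin N) => [|//|->|]; [rewrite fpowersetE|left|right].
Qed.

(** This is what [alpha_neq0] provides to the greedy step. For [alpha = 0] the only layering would
    be the empty one, which violates condition (3), and the polytope, reduced to the zero flow,
    would not be covered. *)
Lemma layering_nonempty L : @is_layering _ _ A L -> exists p, p \in L.
Proof.
move=> Ll; have [i] := alpha_neq0; rewrite neq_lt => /orP[ai|ai].
  have := card_tailY A ai => /andP[+ _]; rewrite lez_nat => /card_gt0P[e _]; have [_ _ Lt] := Ll.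
  have := Lt _ (inY_sink (headY e)); have := netflowY_lt0 (headY e).
  case: (fset_0Vmem L) => [L0|[p pL]]; last by exists p.
  rewrite -[aug_netflow _]/(netflowY _) => lt0 cE; exfalso; move: cE.
  rewrite L0 (_ : [fset p in _ | _]%fset = fset0) ?cardfs0; first by lia.
  by apply/fsetP => p; rewrite !inE.
have := ai; rewrite -(card_headX A ai) ltz_nat => /card_gt0P[e _]; have [p pL _] := layering_start (tailX e) Ll.
by exists p.
Qed.

Section Balanced.
Variable R : realFieldType.
Implicit Types (a : route -> R) (c : R).

(** These are the marginals of the route weights of a combination of layerings with coefficient sum
    [c]. *)
Definition balanced a c :=
  (forall x, \sum_(p <- xroutes | p.1 == inX x) a p = c) /\
  (forall y, \sum_(p <- xroutes | path_end p == inY y) a p = c * `|netflowY y|%:~R).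

Definition startX (p : route) := if p.1 is inl (inr x) then Some x else None.
Definition endY (p : route) := if path_end p is inr y then Some y else None.

Lemma startXE (p : route) x : (p.1 == inX x) = (startX p == Some x).
Proof. by rewrite /startX; case: p.1 => [[]|]. Qed.

Lemma endYE (p : route) y : (path_end p == inY y) = (endY p == Some y).
Proof. by rewrite /endY; case: (path_end p) => [[]|]. Qed.

Lemma sum_fibers (T : finType) (k : route -> option T) (S : {set T}) a :
  \sum_(x in S) \sum_(p <- xroutes | k p == Some x) a p =
  \sum_(p <- xroutes | if k p is Some x then x \in S else false) a p.
Proof.
rewrite (exchange_big_dep xpredT) //= [RHS]big_mkcond /=; apply: eq_bigr => p _.
case kp: (k p) => [x|]; last by rewrite big_pred0 // => x; rewrite andbF.
case: ifP => xS; last first.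
  by rewrite big_pred0 // => y; apply/negP => /andP[yS /eqP[xy]]; rewrite xy yS in xS.
by rewrite (big_pred1 x) // => y; rewrite /= eq_sym; apply/andP/eqP => [[_ /eqP[]]|->].
Qed.

(** Join [x] to [y] when a route of positive weight leads from [x] to [y]. The weight [c * #|S|]
    leaving a set [S] of sources arrives at its neighbours, which absorb [c] times their capacity;
    this is Hall's condition. *)
Lemma balanced_layering a c : {in xroutes, forall p, 0 <= a p} -> 0 < c ->
  balanced a c -> exists L, is_layering L /\ {in L, forall p, 0 < a p}.
Proof.
move=> a0 c0 [bX bY].
pose E := [set xy : VX A * VY A | has (fun p => [&& startX p == Some xy.1, endY p == Some xy.2 & 0 < a p]) xroutes].
pose cap y := `|netflowY (a := A) y|%N.
have bY' y : \sum_(p <- xroutes | path_end p == inY y) a p = c * (cap y)%:R.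
  by rewrite bY /cap natr_absz.
have hE : hall cap E.
  apply/forallP => S.
  rewrite -(ler_nat R) -(ler_pM2l c0) natr_sum mulr_sumr mulr_natr -sumr_const.
  have -> : \sum_(x in S) c = \sum_(x in S) \sum_(p <- xroutes | startX p == Some x) a p.
    by apply: eq_bigr => x _; rewrite -(bX x); apply: eq_bigl => p; rewrite startXE.
  have -> : \sum_(y in neighbours E S) c * (cap y)%:R =
    \sum_(y in neighbours E S) \sum_(p <- xroutes | endY p == Some y) a p.
    by apply: eq_bigr => y _; rewrite -(bY' y); apply: eq_bigl => p; rewrite endYE.
  rewrite !sum_fibers big_mkcond [leRHS]big_mkcond /= big_seq [leRHS]big_seq.
  apply: ler_sum => p px; have ap := a0 p px.
  case sp: (startX p) => [x|]; last by case: ifP.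
  case: ifP => xS; last by case: ifP.
  have [->|apn] := eqVneq (a p) 0; first by case: ifP.
  have [x' [y [e [s [pE _ he _]]]]] := xroutesP dagG px.
  have ep : endY p = Some y by rewrite /endY pE path_end_cons he.
  rewrite ep ifT //; apply/neighboursP; exists x => //.
  by rewrite inE; apply/hasP; exists p => //; rewrite sp ep !eqxx lt_neqAle eq_sym apn.
have [h [hEx hcap]] := hall_capacities hE.
have rx x : exists p, [/\ p \in xroutes, p.1 = inX x, path_end p = inY (h x) & 0 < a p].
  have := hEx x; rewrite inE => /hasP[p px /and3P[]].
  by rewrite -startXE -endYE => /eqP ? /eqP ? ?; exists p.
have [r rP] := choice rx.
have hc y : #|[set x | h x == y]|%N = cap y.
  apply/eqP; rewrite eqn_leq hcap leqNgt; apply/negP => lt.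
  (* All the weight arriving at sinks has left a source, so the total capacity is at most the number
     of sources, and no capacity can remain unfilled. *)
  have tot : (\sum_y cap y <= \sum_y #|[set x | h x == y]|)%N.
    have -> : (\sum_y #|[set x | h x == y]| = #|VX A|)%N.
      rewrite -sum1_card (partition_big h xpredT) //=; apply: eq_bigr => z _.
      by rewrite -sum1_card; apply: eq_bigl => x; rewrite inE.
    rewrite -(ler_nat R) -(ler_pM2l c0) natr_sum mulr_sumr mulr_natr -sumr_const.
    have -> : \sum_(x in VX A) c = \sum_(x in [set: VX A]) \sum_(p <- xroutes | startX p == Some x) a p.
      apply: eq_big => [x|x _]; first by rewrite !inE.
      by rewrite -(bX x); apply: eq_bigl => p; rewrite startXE.
    have -> : \sum_y c * (cap y)%:R =
      \sum_(y in [set: VY A]) \sum_(p <- xroutes | endY p == Some y) a p.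
      apply: eq_big => [y'|y' _]; first by rewrite inE.
      by rewrite -(bY' y'); apply: eq_bigl => p; rewrite endYE.
    rewrite !sum_fibers big_mkcond [leRHS]big_mkcond /= big_seq [leRHS]big_seq.
    apply: ler_sum => p px; have ap := a0 p px.
    have [x' [y' [e [s [pE _ he _]]]]] := xroutesP dagG px.
    have -> : startX p = Some x' by rewrite pE.
    by rewrite inE; case: (endY p) => [?|]; rewrite ?inE.
  move: tot; rewrite leqNgt => /negP[].
  rewrite (bigD1 y) //= [ltnRHS](bigD1 y) //= -addSn.
  by apply: leq_add => //; apply: leq_sum => z _; apply: hcap.
exists [fset r x | x in VX A]%fset; split; last first.
  by move=> p /imfsetP[x _ ->]; have [] := rP x.
apply: (layering_of dagG (v0 := v0) (h := h)) => [x|x|x|y]; try by have [] := rP x.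
by rewrite hc /cap abszE.
Qed.

End Balanced.
Lemma routesP (Ls : seq layering) p :
  reflect (exists2 L, L \in Ls & p \in L) (p \in routes Ls).
Proof.
apply: (iffP (bigfcupP _ _ _ _)) => [[L]|[L LLs pL]]; last by exists L; rewrite ?LLs.
by rewrite andbT => LLs pL; exists L.
Qed.

Lemma routes_cons L (Ls : seq layering) p :
  (p \in routes (L :: Ls)) = (p \in L) || (p \in routes Ls).
Proof. by rewrite /routes big_cons inE. Qed.

Lemma routes_sub (Ls Ms : seq layering) : {subset Ls <= Ms} -> (routes Ls `<=` routes Ms)%fset.
Proof.
by move=> sub; apply/fsubsetP => p /routesP[L /sub LM pL]; apply/routesP; exists L.
Qed.

Lemma route_cliqueW (K K' : {fset route}) : (K' `<=` K)%fset -> route_clique F K -> route_clique F K'.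
Proof.
by move=> /fsubsetP sub [Kr Kc]; split=> [p /sub|p q /sub pK /sub]; [exact: Kr|exact: Kc].
Qed.

Lemma route_cliqueP (K : {fset route}) : {subset K <= xroutes} ->
  route_clique F K <-> {in K &, forall p q, ~ crossing F p q}.
Proof.
move=> Kx; split=> [[_ Kc] p q pK qK|Kc]; last split=> [p /Kx|p q pK qK i []].
- move/(crossingP F dagG (Kx _ pK) (Kx _ qK)) => [i ci].
  by apply: (Kc p q pK qK i); left.
- exact: is_route_xroutes.
- move=> ci; apply: (Kc p q pK qK); apply/(crossingP F dagG (Kx _ pK) (Kx _ qK)); by exists i.
- move=> ci; apply: (Kc q p qK pK); apply/(crossingP F dagG (Kx _ qK) (Kx _ pK)); by exists i.
Qed.

Local Notation simplex := (layering_simplex F).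

Lemma simplex_nil : simplex [::].
Proof.
have cl : route_clique F (routes [::]) by split=> [p|p q] /routesP[].
by split=> //; split=> // i j /andP[].
Qed.

Lemma simplex_cons L Ls : simplex (L :: Ls) <->
  [/\ simplex Ls, is_layering L, route_clique F (routes (L :: Ls)),
      forall M, is_layering M -> (M `<=` routes (L :: Ls))%fset ->
        L = M \/ layering_lt F L M &
      exists2 p, p \in L & p \notin routes Ls].
Proof.
have subc : {subset Ls <= L :: Ls} by move=> M MLs; rewrite inE MLs orbT.
split=> [[[ly lt] cl mn pr]|[[[ly lt] cl mn pr] Ll cl' mn' [p pL pLs]]].
  split=> //.
  - split=> //; first split.
    + by move=> M /subc/ly.
    + by move=> i j ij; apply: (lt i.+1 j.+1).
    + exact: route_cliqueW (routes_sub subc) cl.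
    + by move=> i M iLs; apply: (mn i.+1).
    + by move=> i iLs; apply: (pr i.+1).
  - by apply: ly; rewrite mem_head.
  - by move=> M Ml MK; have [//|->|] := mn 0%N M _ Ml MK; [left|right].
  - by have := pr 0%N isT; rewrite /= drop0.
split=> //.
- split=> [M|[|i] [|j] //].
  + by rewrite inE => /predU1P[->//|/ly].
  (* A later layering is made of routes of [L :: Ls], so minimality puts [L] below it; the private
     route [p] rules out equality. *)
  + rewrite /= ltnS => jLs; have jl := mem_nth fset0 jLs.
    have sub : (nth fset0 Ls j `<=` routes (L :: Ls))%fset.
      by apply/fsubsetP => q qj; rewrite routes_cons; apply/orP; right; apply/routesP; exists (nth fset0 Ls j).
    case: (mn' _ (ly _ jl) sub) => // eqL.
    by case/negP: pLs; apply/routesP; exists (nth fset0 Ls j) => //; rewrite -eqL.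
  + exact: (lt i j).
- move=> [|i] M /= iLs Ml MK; last exact: mn.
  by have [->|] := mn' M Ml MK; [left|right].
- by move=> [|i] /= iLs; [exists p; rewrite ?drop0|apply: pr].
Qed.

(** Discarding layerings only shrinks the sets of routes in conditions (1) to (3). This makes the
    triangulation closed under faces. *)
Lemma simplex_filter (P : pred layering) Ls : simplex Ls -> simplex (filter P Ls).
Proof.
elim: Ls => //= L Ls IH /simplex_cons[/IH sLs Ll cl mn [p pL pLs]].
case: ifP => // PL; apply/simplex_cons.
have sub : {subset filter P Ls <= Ls} by move=> M; rewrite mem_filter => /andP[].
have subc : (routes (L :: filter P Ls) `<=` routes (L :: Ls))%fset.
  by apply: routes_sub => M; rewrite !inE => /predU1P[->|/sub->]; rewrite ?eqxx ?orbT.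
split=> //.
- exact: route_cliqueW cl.
- by move=> M Ml MK; apply: mn => //; apply: fsubset_trans subc.
exists p => //; apply: contra pLs; exact/fsubsetP/routes_sub.
Qed.

Lemma simplex_layering Ls L : simplex Ls -> L \in Ls -> is_layering L.
Proof. by case=> [[ly _] _ _ _]; apply: ly. Qed.

Lemma simplex_uniq Ls : simplex Ls -> uniq Ls.
Proof.
elim: Ls => //= L Ls IH /simplex_cons[/IH -> _ _ _ [p pL pLs]]; rewrite andbT.
by apply: contra pLs => LLs; apply/routesP; exists L.
Qed.

Section Combinations.
Variable R : archiRealFieldType.
Implicit Types (w : layering -> R) (a : route -> R).

Definition route_weight w (Ls : seq layering) (p : route) : R := \sum_(L <- Ls | p \in L) w L.

Lemma route_weight_cons w L Ls p : route_weight w (L :: Ls) p =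
  (if p \in L then w L else 0) + route_weight w Ls p.
Proof. by rewrite /route_weight big_cons; case: ifP; rewrite ?add0r. Qed.

Lemma route_weight_notin w Ls p : p \notin routes Ls -> route_weight w Ls p = 0.
Proof.
move=> pLs; rewrite /route_weight big_seq_cond big1 // => L /andP[LLs pL].
by case/negP: pLs; apply/routesP; exists L.
Qed.

Lemma route_weight_ge0 w Ls p : {in Ls, forall L, 0 < w L} -> 0 <= route_weight w Ls p.
Proof. by move=> w0; rewrite /route_weight big_seq_cond sumr_ge0 // => L /andP[/w0/ltW]. Qed.

Lemma route_weight_gt0 w Ls p : {in Ls, forall L, 0 < w L} ->
  (0 < route_weight w Ls p) = (p \in routes Ls).
Proof.
move=> w0; apply/idP/idP => [|/routesP[L LLs pL]].
  by apply: contraTT => /route_weight_notin->; rewrite ltxx.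
rewrite /route_weight big_mkcond (big_rem L) //= pL; apply: ltr_pwDl; first exact: w0.
rewrite big_seq sumr_ge0 // => M /mem_rem MLs; case: ifP => // _; exact/ltW/w0.
Qed.

(** The support of the common route weight is the set of routes of both simplices. Each first
    layering is minimal in this set, so they agree, and the argument repeats on the tails. *)
Lemma simplex_combination_uniq Ls Ms w u : simplex Ls -> simplex Ms ->
  {in Ls, forall L, 0 < w L} -> {in Ms, forall L, 0 < u L} ->
  route_weight w Ls =1 route_weight u Ms -> Ls = Ms /\ {in Ls, w =1 u}.
Proof.
elim: Ls Ms => [|L Ls IH] [|M Ms] // sL sM w0 u0 eqw.
- have [_ _ _ _ [p pM _]] := (simplex_cons _ _).1 sM.
  have := route_weight_gt0 p u0; rewrite routes_cons pM -eqw /route_weight big_nil.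
  by rewrite ltxx.
- have [_ _ _ _ [p pL _]] := (simplex_cons _ _).1 sL.
  have := route_weight_gt0 p w0; rewrite routes_cons pL eqw /route_weight big_nil.
  by rewrite ltxx.
have [sLs Ll _ mnL [p pL pLs]] := (simplex_cons _ _).1 sL.
have [sMs Ml _ mnM [q qM qMs]] := (simplex_cons _ _).1 sM.
have wLs : {in Ls, forall L, 0 < w L} by move=> N NLs; apply: w0; rewrite inE NLs orbT.
have uMs : {in Ms, forall L, 0 < u L} by move=> N NLs; apply: u0; rewrite inE NLs orbT.
have rr : routes (L :: Ls) = routes (M :: Ms).
  by apply/fsetP => r; rewrite -(route_weight_gt0 _ w0) -(route_weight_gt0 _ u0) eqw.
have sub (N : layering) Ns : (N `<=` routes (N :: Ns))%fset.
  by apply/fsubsetP => r rN; rewrite routes_cons rN.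
have subM : (M `<=` routes (L :: Ls))%fset by rewrite rr sub.
have subL : (L `<=` routes (M :: Ms))%fset by rewrite -rr sub.
have LM : L = M.
  case: (mnL M Ml subM) => // ltLM; case: (mnM L Ll subL) => // ltML.
  exfalso; apply: (layering_lt_irr (F := F) dagG v0 Ll).
  exact: (layering_lt_trans dagG v0 Ll Ml Ll ltLM ltML).
rewrite -LM in sM u0 eqw qM *.
(* The routes private to the first layering may differ in the two simplices, so each of them gives
   only an inequality. *)
have wu : w L = u L.
  apply/eqP; rewrite eq_le; apply/andP; split.
    have := eqw q; rewrite !route_weight_cons qM (route_weight_notin _ qMs) addr0 => <-.
    by rewrite lerDl route_weight_ge0.
  have := eqw p; rewrite !route_weight_cons pL (route_weight_notin _ pLs) addr0 => ->.
  by rewrite lerDl route_weight_ge0.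
have [|-> wuLs] := IH Ms sLs sMs wLs uMs.
  move=> r; have := eqw r; rewrite !route_weight_cons wu; exact: addrI.
by split=> // N; rewrite inE => /predU1P[->|/wuLs].
Qed.

Lemma simplex_combination_int Ls w : simplex Ls ->
  (forall p, route_weight w Ls p \is a Num.int) -> {in Ls, forall L, w L \is a Num.int}.
Proof.
elim: Ls => // L Ls IH /simplex_cons[sLs _ _ _ [p pL pLs]] wi.
have wL : w L \is a Num.int.
  by have := wi p; rewrite route_weight_cons pL route_weight_notin ?addr0.
move=> M; rewrite inE => /predU1P[->//|]; apply: IH => // q.
have := wi q; rewrite route_weight_cons; case: ifP => _; last by rewrite add0r.
by move=> h; rewrite -[route_weight _ _ _](addKr (w L)) rpredD ?rpredN.
Qed.

End Combinations.

End Simplices.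

Section Greedy.
Variables (G : digraph) (alpha : vertex G -> int) (A : augmentation alpha).
Variable F : framing A.
Hypotheses (dagG : is_dag G) (alpha_neq0 : exists i, alpha i != 0).

Local Notation hG := (aug_graph A).
Local Notation route := (gpath hG).
Local Notation layering := {fset route}.

Variables (v0 : vertex hG) (R : archiRealFieldType).
Local Notation xroutes := (xroutes v0).
Local Notation simplex := (layering_simplex F).
Implicit Types (a : route -> R) (c : R) (L : layering).

Lemma sum_xroutes_const (P : pred route) L c : {subset L <= xroutes} ->
  \sum_(p <- xroutes | P p) (if p \in L then c else 0) = c *+ #|` [fset p in L | P p]%fset |.
Proof.
move=> Lx; rewrite -big_mkcondr big_const_seq iter_addr_0; congr (c *+ _).
rewrite -size_filter; apply: perm_size.
apply: uniq_perm; rewrite ?filter_uniq ?uniq_xroutes ?fset_uniq // => p.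
rewrite mem_filter; have -> : (p \in enum_fset [fset p in L | P p]%fset) = (p \in L) && P p.
  by rewrite -[LHS]/(p \in [fset p in L | P p]%fset) !inE.
apply/andP/andP => [[/andP[Pp pL] px]|[pL Pp]]; first by [].
by rewrite Pp pL (Lx _ pL).
Qed.

Lemma layering_balanced L : is_layering L ->
  balanced v0 (fun p => if p \in L then 1 else 0) (1 : R).
Proof.
move=> Ll; have Lx := layering_xroutes dagG v0 Ll; have [_ Ls Lt] := Ll.
split=> [x|y]; rewrite sum_xroutes_const //.
  by have [p ->] := layering_start1 x Ll; rewrite cardfs1.
have : #|` [fset q in L | path_end q == inY y]%fset |%:Z = `|netflowY y| := Lt _ (inY_sink y).
by move=> <-; rewrite mul1r pmulrn.
Qed.

Lemma balancedB a b c d (k : R) : balanced v0 a c -> balanced v0 b d ->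
  balanced v0 (fun p => a p - k * b p) (c - k * d).
Proof.
move=> [aX aY] [bX bY]; split=> [x|y].
  by rewrite sumrB -mulr_sumr aX bX.
by rewrite sumrB -mulr_sumr aY bY mulrBl mulrA.
Qed.

Lemma greedy_simplex a c : (forall p, 0 <= a p) -> uncrossing F v0 a ->
  0 <= c -> balanced v0 a c ->
  exists Ls (w : layering -> R), [/\ simplex Ls, {in Ls, forall L, 0 < w L},
    {in xroutes, forall p, a p = route_weight w Ls p} & \sum_(L <- Ls) w L = c].
Proof.
pose K a := [fset p in xroutes | 0 < a p]%fset.
(* Induction on the size of the support. The added equality [routes Ls = K a] lets minimality and
   private routes be checked on supports. *)
suff H : forall n a c, (#|` K a|%fset < n)%N -> (forall p, 0 <= a p) -> uncrossing F v0 a ->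
  0 <= c -> balanced v0 a c ->
  exists Ls (w : layering -> R), [/\ simplex Ls, {in Ls, forall L, 0 < w L},
    {in xroutes, forall p, a p = route_weight w Ls p}, \sum_(L <- Ls) w L = c
    & routes Ls = K a].
  move=> a0 nc c0 bal; have [Ls [w [? ? ? ? _]]] := H _ _ _ (ltnSn _) a0 nc c0 bal.
  by exists Ls, w.
elim=> // n IH {}a {}c le a0 nc c0 bal.
have inK (b : route -> R) p : (p \in K b) = (p \in xroutes) && (0 < b p) by rewrite !inE.
have [c_0|cpos] := eqVneq c 0.
  have az : {in xroutes, forall p, a p = 0}.
    move=> p px; have [x [y [e [s [pE _ _ _]]]]] := xroutesP dagG px.
    have /eqP := bal.1 x; rewrite c_0 psumr_eq0 // => /allP/(_ p px).
    by rewrite pE eqxx => /eqP.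
  exists [::], (fun=> 0); split=> //.
  - exact: simplex_nil.
  - by move=> p px; rewrite az // /route_weight big_nil.
  - by rewrite big_nil c_0.
  - by apply/fsetP => p; rewrite inK /routes big_nil; case: (boolP (p \in xroutes)) => //= px;
      rewrite az // ltxx.
have {}cpos : 0 < c by rewrite lt_neqAle eq_sym cpos.
have [L1 [L1l L1a]] := balanced_layering dagG (fun p _ => a0 p) cpos bal.
have L1K : (L1 `<=` K a)%fset.
  by apply/fsubsetP => p pL; rewrite inK L1a // (layering_xroutes dagG v0 L1l pL).
have [L [Ll LK Lmin]] := min_layering F dagG v0 (ex_intro2 _ _ L1 L1l L1K).
have Lx := layering_xroutes dagG v0 Ll.
have [p1 p1L] := layering_nonempty alpha_neq0 Ll.
(* The weight of [p0] is the largest multiple of [L] that can be subtracted. It removes [p0] from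
   the support, so [p0] becomes the route of [L] that no later layering contains. *)
have [|p0 [p0L _ p0min]] := @exists_min_seq R _ (enum_fset L) xpredT a.
  by apply/hasP; exists p1.
pose k := a p0.
have kpos : 0 < k by have := fsubsetP LK _ p0L; rewrite inK => /andP[].
pose b p := a p - k * (if p \in L then 1 else 0).
have bE p : b p = if p \in L then a p - k else a p.
  by rewrite /b; case: ifP; rewrite ?mulr1 ?mulr0 ?subr0.
have b0 p : 0 <= b p.
  by rewrite bE; case: ifP => // pL; rewrite subr_ge0; apply: p0min.
have ba p : 0 < b p -> 0 < a p.
  by rewrite bE; case: ifP => // pL; rewrite subr_gt0; apply: lt_trans.
have nb : uncrossing F v0 b by move=> p q px qx /ba ap /ba aq; apply: nc.
have balb : balanced v0 b (c - k) by rewrite -[k in c - k]mulr1; apply: balancedB (layering_balanced Ll).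
(* The remaining sum is the weight that still leaves the starting vertex of [p0]. *)
have ck : 0 <= c - k.
  have [x _] := xroutesP dagG (Lx _ p0L).
  by rewrite -(balb.1 x); apply: sumr_ge0.
have p0b : p0 \notin K b by rewrite inK bE p0L subrr ltxx andbF.
have KbKa : (K b `<=` K a)%fset.
  by apply/fsubsetP => p; rewrite !inK => /andP[-> /ba].
have ltK : (#|` K b|%fset < n)%N.
  have : (K b `<` K a)%fset.
    rewrite fproperE KbKa /=; apply/negP => /fsubsetP/(_ p0 (fsubsetP LK _ p0L)).
    by rewrite (negbTE p0b).
  by move/fproper_ltn_card => lt; move: le; rewrite ltnS; apply: leq_trans.
have [Ls [w [sLs w0 wb wc rLs]]] := IH b (c - k) ltK b0 nb ck balb.
have LLs : L \notin Ls.
  by apply: contra p0b => LLs; rewrite -rLs; apply/routesP; exists L.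
pose u M := if M == L then k else w M.
have uw : {in Ls, u =1 w}.
  by move=> M MLs; rewrite /u; case: eqP => // ML; rewrite -ML MLs in LLs.
have rE : routes (L :: Ls) = K a.
  apply/fsetP => p; rewrite routes_cons rLs !inK; apply/idP/idP.
    by move=> /orP[/(fsubsetP LK)|/andP[-> /ba]] //; rewrite inK.
  by case: (boolP (p \in L)) => //= pL; rewrite bE (negbTE pL).
exists (L :: Ls), u; split=> //.
- apply/simplex_cons; split=> //.
  + apply/(route_cliqueP F dagG (v0 := v0)); first by move=> p; rewrite rE inK => /andP[].
    by move=> p q; rewrite rE !inK => /andP[px ap] /andP[qx aq]; apply: nc.
  + by move=> M Ml; rewrite rE; apply: Lmin.
  + by exists p0 => //; rewrite rLs.
- by move=> M; rewrite inE => /predU1P[->|MLs]; [rewrite /u eqxx|rewrite uw // w0].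
- move=> p px; rewrite route_weight_cons {1}/u eqxx.
  have -> : route_weight u Ls p = route_weight w Ls p.
    by rewrite /route_weight big_seq_cond [RHS]big_seq_cond; apply: eq_bigr => M /andP[/uw].
  by rewrite -wb // bE; case: ifP => _; lra.
rewrite big_cons {1}/u eqxx big_seq (eq_bigr _ uw) -big_seq wc; lra.
Qed.

End Greedy.

(** * Simplices in the space of flows *)

Section Convexity.
Variables (R : realType) (E : finType).
Local Notation vec := {ffun E -> R^o}.

Lemma big_seq_pred1 (M : nmodType) (T : eqType) (s : seq T) t (f : T -> M) :
  uniq s -> t \in s -> \sum_(i <- s | t == i) f i = f t.
Proof.
move=> us ts; rewrite (eq_bigl (pred1 t)); last by move=> i; rewrite /= eq_sym.
by rewrite -big_filter filter_pred1_uniq // big_seq1.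
Qed.

Lemma conv_imageP (T : eqType) (J : T -> vec) (s : seq T) (x : vec) : uniq s ->
  conv [set` [seq J t | t <- s]]%classic x <->
  exists w : T -> R, [/\ {in s, forall t, 0 <= w t}, \sum_(t <- s) w t = 1 &
                        x = \sum_(t <- s) w t *: J t].
Proof.
move=> us; split=> [[n [a [v [a0 a1 vs ->]]]]|[w [w0 w1 ->]]].
  have ex i : exists t, t \in s /\ v i = J t.
    by have /mapP[t ts vt] := vs i; exists t.
  have [l lP] := choice ex.
  exists (fun t => \sum_(i | l i == t) a i); split.
  - by move=> t _; apply: sumr_ge0.
  - rewrite (exchange_big_dep xpredT) //= -a1; apply: eq_bigr => i _.
    by rewrite big_seq_pred1 //; have [] := lP i.
  under [RHS]eq_bigr do rewrite scaler_suml.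
  rewrite [RHS](exchange_big_dep xpredT) //=; apply: eq_bigr => i _.
  by have [ls ->] := lP i; rewrite big_seq_pred1.
exists (size s), (fun i => w (tnth (in_tuple s) i)), (fun i => J (tnth (in_tuple s) i)); split.
- by move=> i; apply: w0; apply: mem_tnth.
- by rewrite -[RHS]w1 [RHS]big_tnth.
- by move=> i; apply: map_f; apply: mem_tnth.
by rewrite big_tnth.
Qed.

Lemma conv_sub (X Y : set vec) : (X `<=` Y -> conv X `<=` conv Y)%classic.
Proof. by move=> XY x [n [a [v [a0 a1 vX ->]]]]; exists n, a, v; split=> // i; apply: XY. Qed.

Lemma free_labels (T : eqType) (v : T -> vec) (s : seq T) (d : T -> R) : uniq s ->
  free [seq v t | t <- s] -> \sum_(t <- s) d t *: v t = 0 -> {in s, forall t, d t = 0}.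
Proof.
move=> us fr sd t ts.
have /freeP H := fr : free (in_tuple [seq v t | t <- s]).
have sz : size [seq v t | t <- s] = size s by rewrite size_map.
have it : (index t s < size [seq v t | t <- s])%N by rewrite sz index_mem.
have := H (fun i => d (nth t s i)) _ (Ordinal it); rewrite /= nth_index //; apply.
rewrite -[RHS]sd (big_nth t) big_mkord -sz; apply: eq_bigr => i _ /=.
by rewrite (nth_map t) // -sz.
Qed.

Lemma labels_free (T : eqType) (v : T -> vec) (s : seq T) : uniq s ->
  (forall d : T -> R, \sum_(t <- s) d t *: v t = 0 -> {in s, forall t, d t = 0}) ->
  free [seq v t | t <- s].
Proof.
move=> us H; suff : free (in_tuple [seq v t | t <- s]) by [].
apply/freeP => k sk i.
have sz : size [seq v t | t <- s] = size s by rewrite size_map.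
case: s us H k sk sz i => [|t0 s'] us H k sk sz i; first by case: i.
set s := t0 :: s' in us H k sk sz i *.
have szi (j : 'I_(size [seq v t | t <- s])) : (j < size s)%N by rewrite -sz.
pose d t := oapp k 0 (insub (index t s)).
have dE (j : 'I_(size [seq v t | t <- s])) : d (nth t0 s j) = k j.
  by rewrite /d index_uniq ?szi // valK.
rewrite -dE; apply: H; last exact: mem_nth (szi i).
rewrite -[RHS]sk (big_nth t0) big_mkord -sz; apply: eq_bigr => j _.
by rewrite dE; congr (_ *: _); exact: (esym (nth_map t0 0 v (szi j))).
Qed.

Lemma affinely_independentP (s : seq vec) : uniq s -> affinely_independent s <->
  forall d : vec -> R, \sum_(v <- s) d v = 0 -> \sum_(v <- s) d v *: v = 0 ->
    {in s, forall v, d v = 0}.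
Proof.
case: s => [|v0 s] us; first by split.
have /= /andP[v0s us'] := us.
have shift (d : vec -> R) : \sum_(v <- v0 :: s) d v = 0 ->
    \sum_(v <- v0 :: s) d v *: v = \sum_(v <- s) d v *: (v - v0).
  rewrite !big_cons => d0; under [RHS]eq_bigr do rewrite scalerBr.
  by rewrite sumrB -scaler_suml addrC; congr (_ + _); rewrite -scaleNr; congr (_ *: _); lra.
rewrite /= /edge_vectors; split=> [fr d d0 dv|H].
  have dz : {in s, forall v, d v = 0}.
    by apply: free_labels fr _ => //; rewrite -shift.
  move=> v; rewrite inE => /predU1P[->|/dz//].
  by move: d0; rewrite big_cons big_seq big1 ?addr0 // => u /dz.
apply: labels_free => // d dv v vs.
pose e u := if u == v0 then - \sum_(v <- s) d v else d u.
have eE : {in s, e =1 d}.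
  by move=> u us2; rewrite /e; case: eqP => // uv; rewrite -uv us2 in v0s.
have se : \sum_(v <- v0 :: s) e v = 0.
  by rewrite big_cons {1}/e eqxx [X in _ + X]big_seq (eq_bigr _ eE) -big_seq addNr.
rewrite -eE //; apply: (H e) => //; last by rewrite inE vs orbT.
rewrite shift // -[RHS]dv !big_seq; apply: eq_bigr => u us2; by rewrite eE.
Qed.

Lemma affinely_independent_uniq (s : seq vec) : affinely_independent s -> uniq s.
Proof.
case: s => //= v0 s fr; apply/andP; split.
  apply/negP => v0s; have : 0 \in edge_vectors v0 s by apply/mapP; exists v0; rewrite ?subrr.
  by move=> /(free_not0 fr); rewrite eqxx.
exact: map_uniq (free_uniq fr).
Qed.

(* The members of an affinely independent family are the extreme points of its hull. *)
Lemma simplex_vertex (s X : seq vec) v : affinely_independent s -> v \in s ->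
  conv [set` s]%classic = conv [set` X]%classic -> v \in X.
Proof.
move=> ai vs eqc; have us := affinely_independent_uniq ai.
have indep := (affinely_independentP us).1 ai.
have convS x : conv [set` s]%classic x <-> exists w : vec -> R,
    [/\ {in s, forall t, 0 <= w t}, \sum_(t <- s) w t = 1 & x = \sum_(t <- s) w t *: t].
  by rewrite -(conv_imageP id x us) map_id.
have : conv [set` undup X]%classic v.
  have -> : [set` undup X]%classic = [set` X]%classic.
    by apply/seteqP; split=> z /=; rewrite mem_undup.
  rewrite -eqc; apply/convS; exists (fun t => (v == t)%:R); split.
  - by move=> t _; apply: ler0n.
  - by rewrite -[RHS](big_seq_pred1 (fun=> 1) us vs) [RHS]big_mkcond /=; apply: eq_bigr => t _; case: eqP.
  rewrite -[LHS](big_seq_pred1 id us vs) [LHS]big_mkcond /=; apply: eq_bigr => t _.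
  by case: eqP; rewrite ?scale1r ?scale0r.
rewrite -[undup X]map_id => /(conv_imageP id v (undup_uniq X)) [w [w0 w1 vE]].
have [x xX wx] : exists2 x, x \in undup X & 0 < w x.
  have [/hasP[x xX wx]|/hasPn none] := boolP (has (fun x => 0 < w x) (undup X)); first by exists x.
  have : \sum_(t <- undup X) w t = 0.
    rewrite big_seq big1 // => t tX; apply/eqP; rewrite eq_le w0 // andbT.
    by have := none t tX; rewrite -leNgt.
  by rewrite w1 => /eqP; rewrite oner_eq0.
have cx z : exists c : vec -> R, z \in undup X ->
    [/\ {in s, forall t, 0 <= c t}, \sum_(t <- s) c t = 1 & z = \sum_(t <- s) c t *: t].
  case: (boolP (z \in undup X)) => zX; last by exists (fun=> 0).
  have : conv [set` s]%classic z.
    rewrite eqc; exists 1%N, (fun=> 1), (fun=> z); split=> //.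
    - by rewrite big_ord1.
    - by move=> _ /=; rewrite -mem_undup.
    - by rewrite big_ord1 scale1r.
  by move=> /convS [c cP]; exists c.
have [c cP] := choice cx.
(* Two expressions of [v] in terms of [s] are subtracted: the one passing through [X], and [v]
   itself. By independence the point [x], whose coefficient is positive, involves no vertex other
   than [v]. *)
pose d t := \sum_(z <- undup X) w z * c z t - (v == t)%:R.
have sumd : \sum_(t <- s) d t = 0.
  rewrite sumrB exchange_big /=.
  have -> : \sum_(z <- undup X) \sum_(t <- s) w z * c z t = 1.
    rewrite -w1 !big_seq; apply: eq_bigr => z zX; rewrite -mulr_sumr.
    by have [_ -> _] := cP z zX; rewrite mulr1.
  have -> : \sum_(t <- s) ((v == t)%:R : R) = 1.
    by rewrite -[RHS](big_seq_pred1 (fun=> 1) us vs) [RHS]big_mkcond /=; apply: eq_bigr => t _; case: eqP.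
  by rewrite subrr.
have sumdv : \sum_(t <- s) d t *: t = 0.
  under eq_bigr do rewrite scalerBl scaler_suml.
  rewrite sumrB exchange_big /=.
  have -> : \sum_(z <- undup X) \sum_(t <- s) (w z * c z t) *: t = v.
    rewrite vE !big_seq; apply: eq_bigr => z zX; have [_ _ zE] := cP z zX.
    transitivity (w z *: \sum_(t <- s) c z t *: t); last by rewrite -zE.
    by rewrite scaler_sumr; apply: eq_bigr => t _; rewrite scalerA.
  have -> : \sum_(t <- s) ((v == t)%:R : R) *: t = v.
    rewrite -[RHS](big_seq_pred1 id us vs) [RHS]big_mkcond /=; apply: eq_bigr => t _.
    by case: eqP; rewrite ?scale1r ?scale0r.
  by rewrite subrr.
have dz := indep d sumd sumdv.
have [c0 c1 xE] := cP x xX.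
have ct t : t \in s -> t != v -> c x t = 0.
  move=> ts tv; have := dz t ts; rewrite /d eq_sym (negbTE tv) subr0 => /eqP.
  rewrite (bigD1_seq x) ?undup_uniq //=.
  have p1 : 0 <= \sum_(i <- undup X | i != x) w i * c i t.
    rewrite big_seq_cond; apply: sumr_ge0 => z /andP[zX _].
    by have [cz _ _] := cP z zX; apply: mulr_ge0; [apply: w0|apply: cz].
  have p2 : 0 <= w x * c x t by rewrite mulr_ge0 ?c0 // ltW.
  by rewrite paddr_eq0 // mulf_eq0 gt_eqF //= => /andP[/eqP].
suff -> : v = x by rewrite -mem_undup.
have others (f : vec -> vec) : \sum_(t <- s) c x t *: f t = c x v *: f v.
  rewrite (bigD1_seq v) //= big_seq_cond big1 ?addr0 // => t /andP[ts tv].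
  by rewrite ct // scale0r.
have cv : c x v = 1.
  rewrite -c1 (bigD1_seq v) //= big_seq_cond big1 ?addr0 // => t /andP[ts tv].
  exact: ct.
by rewrite [RHS]xE (others id) cv scale1r.
Qed.

End Convexity.

(** * Unimodular triangulations from unique positive combinations *)

Section Triangulation.
Variables (R : realType) (E : finType) (T : eqType).
Local Notation vec := {ffun E -> R^o}.
Variables (J : T -> vec) (simp : seq T -> Prop) (P : set vec).

Hypothesis simp_filter : forall (p : pred T) s, simp s -> simp (filter p s).
Hypothesis simp_uniq : forall s, simp s -> uniq s.
Hypothesis simp_finite : exists B : seq T, forall s, simp s -> {subset s <= B}.
Hypothesis simp_integer : forall s t, simp s -> t \in s -> integer_point (J t).
Hypothesis simp_sub : forall s t, simp s -> t \in s -> P (J t).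
Hypothesis P_convex : (conv P `<=` P)%classic.
Hypothesis simp_cover : forall x, P x -> exists s (w : T -> R),
  [/\ simp s, {in s, forall t, 0 < w t}, \sum_(t <- s) w t = 1 &
      x = \sum_(t <- s) w t *: J t].
(** The two coefficient sums are equal but not normalized to 1, which leaves room for adding a
    constant to all the coefficients. *)
Hypothesis simp_inj : forall s s' (w w' : T -> R), simp s -> simp s' ->
  {in s, forall t, 0 < w t} -> {in s', forall t, 0 < w' t} ->
  \sum_(t <- s) w t = \sum_(t <- s') w' t ->
  \sum_(t <- s) w t *: J t = \sum_(t <- s') w' t *: J t ->
  s = s' /\ {in s, w =1 w'}.
Hypothesis simp_lattice : forall s (d : T -> R), simp s -> \sum_(t <- s) d t = 0 ->
  integer_point (\sum_(t <- s) d t *: J t) -> {in s, forall t, d t \is a Num.int}.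

Definition cell (s : seq T) : set vec := conv [set J t | t in [set` s]]%classic.

Lemma image_set_mem (s : seq T) :
  ([set J t | t in [set` s]] = [set` [seq J t | t <- s]])%classic.
Proof.
apply/seteqP; split=> [x [t ts <-]|x /= /mapP[t ts ->]]; first exact: map_f.
by exists t.
Qed.

Lemma cellE s : cell s = conv [set` [seq J t | t <- s]]%classic.
Proof. by rewrite /cell image_set_mem. Qed.

Lemma cell_sub s s' : {subset s <= s'} -> (cell s `<=` cell s')%classic.
Proof. by move=> ss'; apply: conv_sub => x [t /ss' ts' <-]; exists t. Qed.

Lemma cell_eq s s' : s =i s' -> cell s = cell s'.
Proof. by move=> ss'; apply/seteqP; split; apply: cell_sub => t; rewrite ss'. Qed.

Lemma cell_pos s x : simp s -> cell s x -> exists (w : T -> R),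
  let s' := filter (fun t => 0 < w t) s in
  [/\ simp s', {in s', forall t, 0 < w t}, \sum_(t <- s') w t = 1 &
      x = \sum_(t <- s') w t *: J t].
Proof.
move=> ss; rewrite cellE => /(conv_imageP J x (simp_uniq ss)) [w [w0 w1 xE]].
have wz t : t \in s -> ~~ (0 < w t) -> w t = 0.
  by move=> ts; rewrite -leNgt => le; apply/eqP; rewrite eq_le le w0.
exists w; split.
- exact: simp_filter.
- by move=> t; rewrite mem_filter => /andP[].
- rewrite -w1 big_filter big_mkcond !big_seq /=; apply: eq_bigr => t ts.
  by case: ifPn => // /(wz _ ts).
rewrite xE big_filter [RHS]big_mkcond !big_seq /=; apply: eq_bigr => t ts.
by case: ifPn => // /(wz _ ts) ->; rewrite scale0r.
Qed.

Lemma pos_cell s (w : T -> R) : uniq s -> {in s, forall t, 0 <= w t} ->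
  \sum_(t <- s) w t = 1 -> cell s (\sum_(t <- s) w t *: J t).
Proof. by move=> us w0 w1; rewrite cellE; apply/conv_imageP => //; exists w. Qed.

(* Adding a large multiple of the barycentre makes all the coefficients positive. *)
Lemma simp_independent s (d : T -> R) : simp s -> \sum_(t <- s) d t = 0 ->
  \sum_(t <- s) d t *: J t = 0 -> {in s, forall t, d t = 0}.
Proof.
move=> ss d0 dJ t ts.
pose N := 1 + \sum_(t <- s) `|d t|.
have dN u : u \in s -> `|d u| < N.
  move=> us; rewrite /N (bigD1_seq u) ?simp_uniq //=.
  have : 0 <= \sum_(i <- s | i != u) `|d i| by apply: sumr_ge0.
  lra.
have [||||_ H] := @simp_inj s s (fun t => N + d t) (fun=> N) ss ss.
- by move=> u us; have := dN u us; rewrite ltr_norml; lra.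
- by move=> u us; apply: le_lt_trans (normr_ge0 (d u)) (dN u us).
- by rewrite big_split /= d0 addr0.
- by under eq_bigr do rewrite scalerDl; rewrite big_split /= dJ addr0.
by have := H t ts; lra.
Qed.

Lemma simp_map_uniq s : simp s -> uniq [seq J t | t <- s].
Proof.
move=> ss; rewrite map_inj_in_uniq ?simp_uniq // => t u ts us Jtu.
apply/eqP/negPn/negP => tu.
have us' := simp_uniq ss.
pose d v : R := (t == v)%:R - (u == v)%:R.
have del (f : T -> vec) v : v \in s -> \sum_(i <- s) (v == i)%:R *: f i = f v.
  move=> vs; rewrite -[RHS](big_seq_pred1 f us' vs) [RHS]big_mkcond /=.
  by apply: eq_bigr => i _; case: eqP; rewrite ?scale1r ?scale0r.
have del1 v : v \in s -> \sum_(i <- s) ((v == i)%:R : R) = 1.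
  move=> vs; rewrite -[RHS](big_seq_pred1 (fun=> 1) us' vs) [RHS]big_mkcond /=.
  by apply: eq_bigr => i _; case: eqP.
have := @simp_independent s d ss _ _ t ts; rewrite /d eqxx eq_sym (negbTE tu) subr0.
move=> H; have : (1 : R) = 0; last by move/eqP; rewrite oner_eq0.
apply: H; first by rewrite sumrB !del1 // subrr.
by under eq_bigr do rewrite scalerBl; rewrite sumrB !del // Jtu subrr.
Qed.

Lemma simp_affinely_independent s : simp s -> affinely_independent [seq J t | t <- s].
Proof.
move=> ss; apply/affinely_independentP; first exact: simp_map_uniq.
move=> d; rewrite !big_map => d0 dJ v /mapP[t ts ->].
exact: (@simp_independent s (d \o J)).
Qed.

Lemma cell_face_filter (p : pred T) s : simp s -> face (cell (filter p s)) (cell s).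
Proof.
move=> ss; exists [seq J t | t <- s], [seq J t | t <- filter p s]; split.
- exact: simp_affinely_independent.
- exact: cellE.
- by move=> v /mapP[t]; rewrite mem_filter => /andP[_ ts] ->; apply: map_f.
- exact: cellE.
Qed.

(** The positive representation of a common point is unique, so it is supported on labels of both
    cells. *)
Lemma cell_capE s s' : simp s -> simp s' ->
  (cell s `&` cell s' = cell (filter (mem s') s))%classic.
Proof.
move=> ss ss'; apply/seteqP; split=> [x [xs xs']|x xc]; last first.
  by split; apply: cell_sub xc => t; rewrite mem_filter /= => /andP[].
have [w [sw w0 w1 xE]] := cell_pos ss xs.
have [u [su u0 u1 xE']] := cell_pos ss' xs'.
have [||e _] := simp_inj sw su w0 u0; [by rewrite w1 u1|by rewrite -xE -xE'|].
rewrite xE; apply: (cell_sub (s := filter (fun t => 0 < w t) s)).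
  move=> t tw; have := tw; rewrite {1}e !mem_filter /= => /andP[_ ->].
  by move: tw; rewrite mem_filter => /andP[_ ->].
apply: pos_cell => //; first exact: simp_uniq.
by move=> t /w0/ltW.
Qed.

(** A face may be presented through any affinely independent list with the same hull;
    [simplex_vertex] shows that its members are still of the form [J l] with [l] in [s]. *)
Lemma face_cell s F' : simp s -> face F' (cell s) ->
  exists2 s', simp s' & F' = cell s'.
Proof.
move=> ss [sv [t [ai cE tsv ->]]]; rewrite cellE in cE.
exists (filter (fun l => J l \in t) s); first exact: simp_filter.
rewrite cellE; congr conv; apply/seteqP; split=> v /=.
  move=> vt; have /mapP[l ls vE] := simplex_vertex ai (tsv v vt) (esym cE).
  by rewrite vE; apply: map_f; rewrite mem_filter ls -vE vt.
by move=> /mapP[l]; rewrite mem_filter => /andP[lt _] ->.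
Qed.

Theorem cells_triangulation : lattice_triangulation P [set cell s | s in simp]%classic.
Proof.
split.
- have [B BP] := simp_finite.
  pose B' := [seq J t | t <- B & `[< exists2 s, simp s & t \in s >]].
  have B'P v : v \in B' <-> exists t s, [/\ simp s, t \in s & v = J t].
    split=> [/mapP[t]|[t [s [ss ts ->]]]].
      by rewrite mem_filter => /andP[/asboolP[s ss ts] _] ->; exists t, s.
    by apply: map_f; rewrite mem_filter (BP s) // andbT; apply/asboolP; exists s.
  exists B'; split=> [v /B'P[t [s [ss ts ->]]]|]; first exact: simp_integer ts.
  apply/seteqP; split=> x.
    move=> /simp_cover[s [w [ss w0 w1 ->]]].
    have : cell s (\sum_(t <- s) w t *: J t).
      by apply: pos_cell w1; [exact: simp_uniq|move=> t /w0/ltW].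
    by apply: conv_sub => _ [t ts <-]; apply/B'P; exists t, s.
  move=> xB; apply: P_convex; apply: conv_sub xB => v /= /B'P[t [s [ss ts ->]]].
  exact: simp_sub ts.
- split.
    have [B BP] := simp_finite.
    (* A cell depends only on the set of its labels, so the masks of [B] give every cell, whatever
       the order of the labels in a simplex. *)
    pose g (m : (size B).-tuple bool) := cell (mask m B).
    apply: (@sub_finite_set _ _ (g @` [set: (size B).-tuple bool])%classic); last exact: finite_image finite_finset.
    move=> _ [s ss <-]; exists [tuple of [seq b \in s | b <- in_tuple B]] => //.
    apply: cell_eq => t; rewrite -filter_mask mem_filter.
    by apply/andb_idr; apply: BP.
  move=> _ [s ss <-]; exists [seq J t | t <- s]; split.
  - by move=> v /mapP[t ts ->]; apply: simp_integer ts.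
  - exact: simp_affinely_independent.
  - exact: cellE.
- apply/seteqP; split=> [x [_ [s ss <-] xs]|x /simp_cover[s [w [ss w0 w1 ->]]]].
    by apply: P_convex; apply: conv_sub xs => _ [t ts <-]; apply: simp_sub ts.
  exists (cell s); first by exists s.
  by apply: pos_cell w1; [exact: simp_uniq|move=> t /w0/ltW].
- by move=> _ F' [s ss <-] /(face_cell ss)[s' ss' ->]; exists s'.
move=> _ _ [s ss <-] [s' ss' <-]; split; first by rewrite cell_capE //; apply: cell_face_filter.
by rewrite classical_sets.setIC cell_capE //; apply: cell_face_filter.
Qed.

Lemma simp_lattice_edges t0 s (d : T -> R) : simp (t0 :: s) ->
  integer_point (\sum_(t <- s) d t *: (J t - J t0)) -> {in s, forall t, d t \is a Num.int}.
Proof.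
move=> ss di t ts; have /= /andP[t0s us] := simp_uniq ss.
pose e u := if u == t0 then - \sum_(t <- s) d t else d u.
have eE : {in s, e =1 d}.
  by move=> u us2; rewrite /e; case: eqP => // ut; rewrite -ut us2 in t0s.
have e0 : e t0 = - \sum_(t <- s) d t by rewrite /e eqxx.
have sE (f : T -> vec) : \sum_(t <- s) e t *: f t = \sum_(t <- s) d t *: f t.
  by rewrite !big_seq; apply: eq_bigr => u /eE ->.
rewrite -eE //; apply: (simp_lattice ss); last by rewrite inE ts orbT.
  by rewrite big_cons e0 big_seq (eq_bigr _ eE) -big_seq addNr.
rewrite big_cons e0 sE scaleNr scaler_suml addrC -sumrB.
by under eq_bigr do rewrite -scalerBr.
Qed.

(** The edge vectors themselves serve as the basis of the lattice, by [simp_lattice_edges], so the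
    matrix of the volume is the identity. *)
Theorem cells_unimodular : unimodular [set cell s | s in simp]%classic.
Proof.
move=> _ [s ss <-] [x].
case: s ss => [|t0 s] ss.
  by rewrite cellE => -[[|n] [a [v [_ a1 vs _]]]]; [move: a1; rewrite big_ord0 => /eqP; rewrite eq_sym oner_eq0|have := vs ord0].
move=> _; have ai := simp_affinely_independent ss.
pose sv := in_tuple [seq J t | t <- s].
have bs : size (edge_vectors (J t0) sv) == size [seq J t | t <- s].
  by apply/eqP; exact: size_map.
exists (size [seq J t | t <- s]), (J t0), sv, (Tuple bs).
have fr : free (Tuple bs) by exact: ai.
have bE (i : 'I_(size [seq J t | t <- s])) : (Tuple bs)`_i = J (nth t0 s i) - J t0.
  by rewrite /= (nth_map (J t0)) // (nth_map t0) // -[ltnRHS](size_map J).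
split=> //; first by rewrite cellE.
- split.
  + by rewrite basisEfree fr subvv /= (eqP fr).
  + move=> i e; have := mem_tnth i (Tuple bs) => /mapP[_ /mapP[t ts ->]] ->.
    rewrite !ffunE; apply: rpredB; apply: (simp_integer ss); rewrite ?mem_head //.
    by rewrite inE ts orbT.
  move=> y ys yi; have yE := @coord_span _ _ _ (Tuple bs) y ys.
  have us : uniq s by have /= /andP[] := simp_uniq ss.
  pose k i := coord (Tuple bs) i y.
  pose d t := oapp k 0 (insub (index t s)).
  have sz (i : 'I_(size [seq J t | t <- s])) : (i < size s)%N by rewrite -[ltnRHS](size_map J).
  have dE (i : 'I_(size [seq J t | t <- s])) : d (nth t0 s i) = k i.
    by rewrite /d index_uniq ?sz // valK.
  have yd : y = \sum_(t <- s) d t *: (J t - J t0).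
    rewrite [LHS]yE (big_nth t0) big_mkord -(size_map J); apply: eq_bigr => i _.
    by rewrite dE bE.
  rewrite yd in yi; have ki i : exists c : int, k i = c%:~R.
    by apply/intrP; rewrite -dE; apply: (simp_lattice_edges ss yi); apply: mem_nth (sz i).
  have [c cE] := choice ki.
  exists c; rewrite [LHS]yE; apply: eq_bigr => i _.
  by rewrite -/(k i) cE scaler_int (tnth_nth 0).
apply/esym.
have -> : (\matrix_(i, j) (coord (Tuple bs) j (tnth sv i - J t0) : R)) = 1%:M.
  apply/matrixP => i j; rewrite !mxE -(coord_free i j fr) bE.
  by rewrite (tnth_nth (J t0)) /= (nth_map t0) // -[ltnRHS](size_map J).
by rewrite det1 normr1.
Qed.

End Triangulation.

(** * Flows and layerings *)

Section LayeringFlows.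
Variables (G : digraph) (alpha : vertex G -> int) (A : augmentation alpha).
Variable F : framing A.
Hypotheses (dagG : is_dag G) (alpha_neq0 : exists i, alpha i != 0).

Local Notation hG := (aug_graph A).
Local Notation harc := (Defs.arc hG).
Local Notation route := (gpath hG).
Local Notation layering := {fset route}.

Variables (v0 : vertex hG) (R : realType).
Local Notation xroutes := (xroutes v0).
Local Notation simplex := (layering_simplex F).
Local Notation vec := {ffun Defs.arc G -> R^o}.
Implicit Types (a : route -> R) (c : R) (L : layering) (Ls : seq layering) (x : vec).

(* The flow on the augmented graph extending [x], with value [c] on every inflow edge. *)
Definition hat_flow c x (e : harc) : R :=
  match e with
  | inl (inl e) => x e
  | inl (inr _) => c
  | inr e => c * `|netflowY (headY e)|%:~R
  end.

Lemma sum_hat_head c x i :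
  \sum_(e in [pred e | headV e == Some i]) hat_flow c x e =
  \sum_(e | Defs.head e == i) (x e : R) + c * (Num.max (alpha i) 0)%:~R.
Proof.
rewrite !big_sumType /= [X in _ + X]big1 ?addr0 //; congr (_ + _).
rewrite sumr_const -mulr_natr; congr (_ * _).
have [ai|ai] := ltP 0 (alpha i); last first.
  rewrite (eq_card0 (A := _)) // => e; rewrite inE /=.
  by apply/negP => /eqP[ei]; have := headX_gt0 e; rewrite ei ltNge ai.
rewrite -(card_headX A ai) -pmulrn; congr (_%:R); apply: eq_card => e.
by rewrite !inE.
Qed.

Lemma sum_hat_tail c x i :
  \sum_(e in [pred e | tailV e == Some i]) hat_flow c x e =
  \sum_(e | Defs.tail e == i) (x e : R) + c * (Num.max (- alpha i) 0)%:~R.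
Proof.
rewrite !big_sumType /= [X in _ + X + _]big1 ?addr0 //; congr (_ + _).
rewrite -mulr_sumr; congr (_ * _); rewrite -rmorph_sum /=; congr (_%:~R).
have [ai|ai] := ltP (alpha i) 0; last first.
  rewrite big1 ?max_r ?oppr_le0 // => e; rewrite inE /= => /eqP[ei].
  by have := tailY_lt0 e; rewrite ei ltNge ai.
rewrite max_l ?oppr_ge0 ?(ltW ai) // [in RHS](netflowY_sum A ai) -sumrN.
apply: eq_big => [e|e _]; first by rewrite inE.
by rewrite ltr0_norm ?netflowY_lt0.
Qed.

(** The inflow edges bring [c] times the positive part of [alpha i] into [i], and the outflow edges
    carry away [c] times its negative part. *)
Lemma hat_flow_conserved c x :
  (forall i, \sum_(e in [pred e | headV e == Some i]) hat_flow c x e =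
             \sum_(e in [pred e | tailV e == Some i]) hat_flow c x e) <->
  forall i, \sum_(e | Defs.tail e == i) (x e : R) - \sum_(e | Defs.head e == i) (x e : R)
    = c * (alpha i)%:~R.
Proof.
have alphaE i : (alpha i)%:~R = (Num.max (alpha i) 0)%:~R - (Num.max (- alpha i) 0)%:~R :> R.
  by rewrite -intrB; congr (_%:~R); case: (leP (alpha i) 0) => ?; case: (leP (- alpha i) 0) => ?; lia.
split=> H i; have := H i; rewrite !sum_hat_head !sum_hat_tail alphaE mulrBr.
  by lra.
by lra.
Qed.

Lemma big_layering (M : nmodType) (P : pred route) (f : route -> M) L : is_layering L ->
  \sum_(p <- xroutes | P p && (p \in L)) f p = \sum_(p <- L | P p) f p.
Proof.
move=> Ll; have Lx := layering_xroutes dagG v0 Ll.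
rewrite (eq_bigl (fun p => (p \in L) && P p)); last by move=> p; rewrite andbC.
rewrite -big_filter_cond; apply: perm_big; apply: uniq_perm; rewrite ?filter_uniq ?uniq_xroutes ?fset_uniq //.
by move=> p; rewrite mem_filter; apply/andb_idr; apply: Lx.
Qed.

Lemma flow_of_route_weight (w : layering -> R) Ls g : {in Ls, forall L, is_layering L} ->
  flow_of v0 (route_weight w Ls) g =
  \sum_(L <- Ls) w L * \sum_(p <- L) (g \in p.2)%:R.
Proof.
move=> ly; rewrite /flow_of /route_weight (exchange_big_dep xpredT) //= !big_seq.
apply: eq_bigr => L /ly Ll; rewrite (big_layering (fun p => g \in p.2)) //.
by rewrite mulr_sumr big_mkcond; apply: eq_bigr => p _; case: ifP; rewrite ?mulr1 ?mulr0.
Qed.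

Lemma combination_flow (w : layering -> R) Ls e : {in Ls, forall L, is_layering L} ->
  (\sum_(L <- Ls) w L *: layering_vector R L) e = flow_of v0 (route_weight w Ls) (Defs.inE A e).
Proof.
move=> ly; rewrite flow_of_route_weight // sum_ffunE; apply: eq_bigr => L _.
rewrite ffunE /layering_vector sum_ffunE; congr (_ * _); apply: eq_bigr => p _.
by rewrite ffunE.
Qed.

Lemma balanced_route_weight (w : layering -> R) Ls : {in Ls, forall L, is_layering L} ->
  balanced v0 (route_weight w Ls) (\sum_(L <- Ls) w L).
Proof.
elim: Ls => [|L Ls IH] ly.
  by split=> ?; rewrite big1 ?big_nil ?mul0r // => p _; rewrite /route_weight big_nil.
have := balancedB (- w L) (IH (fun M ML => ly M (mem_behead (s := L :: Ls) ML)))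
  (layering_balanced dagG v0 R (ly L (mem_head _ _))).
rewrite mulr1 opprK big_cons addrC; congr balanced.
apply/funext => p; rewrite route_weight_cons addrC; congr (_ + _).
by case: ifP => _; rewrite ?mulr1 ?mulr0 ?opprK ?oppr0.
Qed.

Lemma balanced_flowP a c :
  balanced v0 a c <->
  (forall e, flow_of v0 a (inl (inr e)) = c) /\
  (forall e, flow_of v0 a (inr e) = c * `|netflowY (headY e)|%:~R).
Proof.
have sX e : flow_of v0 a (inl (inr e)) = \sum_(p <- xroutes | p.1 == inX (tailX e)) a p.
  rewrite /flow_of big_seq_cond [RHS]big_seq_cond; apply: eq_bigl => p.
  by apply: andb_id2l => px; rewrite (mem_sourceE dagG _ px).
have sY e : flow_of v0 a (inr e) = \sum_(p <- xroutes | path_end p == inY (headY e)) a p.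
  rewrite /flow_of big_seq_cond [RHS]big_seq_cond; apply: eq_bigl => p.
  by apply: andb_id2l => px; rewrite (mem_sinkE dagG _ px).
split=> -[aX aY]; split=> z; rewrite ?sX ?sY //.
  by have [e ez] := VX_tail z; rewrite -ez -sX.
by have [e ez] := VY_head z; rewrite -ez -sY.
Qed.

(** The flow on the added arcs depends on the coefficient sum alone. Hence that sum and a point of
    [R^E] determine the whole augmented flow, and with it the uncrossing weights. *)
Lemma route_weight_hat (w : layering -> R) Ls g : {in Ls, forall L, is_layering L} ->
  flow_of v0 (route_weight w Ls) g =
  hat_flow (\sum_(L <- Ls) w L) (\sum_(L <- Ls) w L *: layering_vector R L) g.
Proof.
move=> ly; have [fX fY] := (balanced_flowP _ _).1 (balanced_route_weight w ly).
by case: g => [[e|e]|e]; [rewrite /= combination_flow|exact: fX|exact: fY].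
Qed.

Lemma layering_flow L : is_layering L -> flow_polytope R alpha (layering_vector R L).
Proof.
move=> Ll; have ly : {in [:: L], forall L, is_layering L} by move=> M; rewrite inE => /eqP->.
have JE : \sum_(M <- [:: L]) 1 *: layering_vector R M = layering_vector R L.
  by rewrite big_seq1 scale1r.
split=> [e|i].
  by rewrite /layering_vector sum_ffunE; apply: sumr_ge0 => p _; rewrite ffunE ler0n.
rewrite -[RHS]mul1r; move: i; apply/hat_flow_conserved => i.
have hE g : hat_flow 1 (layering_vector R L) g = flow_of v0 (route_weight (fun=> 1) [:: L]) g.
  by rewrite (route_weight_hat (fun=> 1)) // JE big_seq1.
under eq_bigr do rewrite hE; under [RHS]eq_bigr do rewrite hE.
exact: flow_of_conserved.
Qed.

Lemma layering_vector_int L : integer_point (layering_vector R L).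
Proof.
by move=> e; rewrite /layering_vector sum_ffunE; apply: rpred_sum => p _; rewrite ffunE; apply: natr_int.
Qed.

Lemma flow_polytope_convex : (conv (flow_polytope R alpha) `<=` flow_polytope R alpha)%classic.
Proof.
move=> x [n [a [v [a0 a1 vP ->]]]]; split=> [e|i].
  rewrite sum_ffunE; apply: sumr_ge0 => k _; rewrite ffunE.
  by apply: mulr_ge0 => //; have [+ _] := vP k; apply.
have lin (P : pred (Defs.arc G)) : \sum_(e | P e) ((\sum_k a k *: v k) e : R) =
    \sum_k a k * \sum_(e | P e) (v k e : R).
  under [RHS]eq_bigr do rewrite mulr_sumr.
  rewrite [RHS]exchange_big /=; apply: eq_bigr => e _; rewrite sum_ffunE.
  by apply: eq_bigr => k _; rewrite ffunE.
rewrite !lin -sumrB; transitivity ((\sum_k a k) * (alpha i)%:~R); last by rewrite a1 mul1r.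
rewrite mulr_suml; apply: eq_bigr => k _.
by rewrite -mulrBr; have [_ ->] := vP k.
Qed.

Lemma simplex_uncrossing (w : layering -> R) Ls : simplex Ls -> {in Ls, forall L, 0 < w L} ->
  uncrossing F v0 (route_weight w Ls).
Proof.
move=> sL w0 p q px qx; rewrite !route_weight_gt0 // => pL qL.
have [_ cl _ _] := sL; have Lx : {subset routes Ls <= xroutes}.
  by move=> r /routesP[L /(simplex_layering sL) Ll rL]; apply: layering_xroutes Ll _ rL.
exact: (route_cliqueP F dagG Lx).1 cl p q pL qL.
Qed.

Lemma flow_simplex_combination x : flow_polytope R alpha x ->
  exists Ls (w : layering -> R), [/\ simplex Ls, {in Ls, forall L, 0 < w L},
    \sum_(L <- Ls) w L = 1 & x = \sum_(L <- Ls) w L *: layering_vector R L].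
Proof.
move=> [x0 xa]; have f0 g : 0 <= hat_flow 1 x g.
  by case: g => [[e|e]|e] //=; rewrite mul1r ler0z.
have fc : forall i, \sum_(e in [pred e | headV e == Some i]) hat_flow 1 x e =
             \sum_(e in [pred e | tailV e == Some i]) hat_flow 1 x e.
  by apply/hat_flow_conserved => i; rewrite mul1r.
have [a [a0 nc af]] := uncrossing_decomposition F dagG v0 f0 fc.
have bal : balanced v0 a 1 by apply/balanced_flowP; split=> e; rewrite af.
have [Ls [w [sL w0 aw w1]]] := greedy_simplex dagG alpha_neq0 a0 nc ler01 bal.
exists Ls, w; split=> //; apply/ffunP => e.
rewrite combination_flow; last by move=> L; apply: (simplex_layering sL).
rewrite -[LHS]/(hat_flow 1 x (Defs.inE A e)) -af /flow_of big_seq_cond [RHS]big_seq_cond.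
by apply: eq_bigr => p /andP[px _]; apply: aw.
Qed.

Lemma route_weight_out (w : layering -> R) Ls p : {in Ls, forall L, is_layering L} ->
  p \notin xroutes -> route_weight w Ls p = 0.
Proof.
move=> ly px; apply: route_weight_notin; apply: contra px => /routesP[L /ly Ll].
exact: layering_xroutes.
Qed.

Lemma simplex_layering_inj Ls Ms (w u : layering -> R) : simplex Ls -> simplex Ms ->
  {in Ls, forall L, 0 < w L} -> {in Ms, forall L, 0 < u L} ->
  \sum_(L <- Ls) w L = \sum_(L <- Ms) u L ->
  \sum_(L <- Ls) w L *: layering_vector R L = \sum_(L <- Ms) u L *: layering_vector R L ->
  Ls = Ms /\ {in Ls, w =1 u}.
Proof.
move=> sL sM w0 u0 wu wuJ.
have lyL : {in Ls, forall L, is_layering L} by move=> L; apply: (simplex_layering sL).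
have lyM : {in Ms, forall L, is_layering L} by move=> L; apply: (simplex_layering sM).
apply: (simplex_combination_uniq dagG v0 sL sM) => // p.
have [px|px] := boolP (p \in xroutes); last by rewrite !route_weight_out.
apply: (uncrossing_weight_uniq (F := F) dagG (v0 := v0)) px.
- by move=> q _; apply: route_weight_ge0.
- by move=> q _; apply: route_weight_ge0.
- exact: simplex_uncrossing.
- exact: simplex_uncrossing.
by move=> g; rewrite !route_weight_hat // wu wuJ.
Qed.

Lemma simplex_layering_lattice Ls (d : layering -> R) : simplex Ls ->
  \sum_(L <- Ls) d L = 0 -> integer_point (\sum_(L <- Ls) d L *: layering_vector R L) ->
  {in Ls, forall L, d L \is a Num.int}.
Proof.
move=> sL d0 di L LLs.
have lyL : {in Ls, forall L, is_layering L} by move=> M; apply: (simplex_layering sL).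
(* The shift has to be an integer as well as large, so that integrality of [N + d] gives integrality
   of [d]. *)
pose N : R := (Num.bound (\sum_(L <- Ls) `|d L|))%:R.
have Ni : N \is a Num.int by apply: natr_int.
have dN M : M \in Ls -> `|d M| < N.
  move=> MLs; apply: le_lt_trans (archi_boundP _); last by apply: sumr_ge0.
  by rewrite (bigD1_seq M) ?(simplex_uniq sL) //= lerDl sumr_ge0.
pose w M := N + d M.
have w0 : {in Ls, forall M, 0 < w M}.
  by move=> M /dN; rewrite /w ltr_norml; lra.
suff : w L \is a Num.int by move=> wi; rewrite -[d L](addKr N) rpredD ?rpredN.
apply: (simplex_combination_int sL) LLs => p.
have [px|px] := boolP (p \in xroutes); last by rewrite route_weight_out.
apply: (uncrossing_weight_int (F := F) dagG (v0 := v0)) px.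
- by move=> q _; apply: route_weight_ge0.
- exact: simplex_uncrossing.
(* This is the flow on every inflow edge; the coefficients [d] add up to 0 and contribute
   nothing. *)
have wi : \sum_(M <- Ls) w M \is a Num.int.
  by rewrite big_split /= d0 addr0; apply: rpred_sum.
move=> g; rewrite route_weight_hat //; case: g => [[e|e]|e] //=; last by rewrite rpredM ?intr_int.
under eq_bigr do rewrite /w scalerDl.
rewrite big_split /= ffunE; apply: rpredD; last exact: di.
rewrite sum_ffunE; apply: rpred_sum => M _; rewrite ffunE; apply: rpredM => //.
exact: layering_vector_int.
Qed.

End LayeringFlows.

Theorem theorem4p8 (R : realType) (G : digraph) (alpha : vertex G -> int)
    (dagG : is_dag G) (alpha_neq0 : exists i, alpha i != 0)
    (A : augmentation alpha) (F : framing A) :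
  lattice_triangulation (flow_polytope R alpha) (layering_triangulation R F) /\
  unimodular (layering_triangulation R F).
Proof.
have [i0 _] := alpha_neq0; pose v0 : vertex (aug_graph A) := inV A i0.
have ftr := simplex_filter (F := F); have unq := @simplex_uniq _ _ _ F.
have int s L : layering_simplex F s -> L \in s -> integer_point (layering_vector R L).
  by move=> _ _; apply: layering_vector_int.
have inj := simplex_layering_inj (F := F) dagG v0 (R := R).
split; last first.
  apply: (cells_unimodular unq int inj); exact: (simplex_layering_lattice dagG v0).
apply: (cells_triangulation ftr unq _ int _ _ _ inj).
(* Every layering is a subset of the finite list [xroutes]. *)
- exists (enum_fset (fpowerset [fset p in xroutes v0]%fset)) => s ss L Ls.
  rewrite -[_ \in _]/(L \in fpowerset _) fpowersetE; apply/fsubsetP => p pL.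
  by rewrite inE; apply: layering_xroutes pL => //; apply: simplex_layering ss Ls.
- by move=> s L ss Ls; apply: (layering_flow dagG v0); apply: simplex_layering ss Ls.
- exact: flow_polytope_convex.
- exact: flow_simplex_combination.
Qed.
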